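(* The weights $w^*$ can be computed in polynomial time: there is an algorithm that, given as input any network $(N,E)$ satisfying the standing assumptions, outputs the vector $w^*=(w_i^* )_{i\in N}$ in time polynomial in $n=|N|$ (even though the number $|\mathcal{P}|$ of paths can be exponential in $n$).
   Context: Network (standing assumptions). $(N,E)$ is a finite directed graph with $|N|\ge 3$ nodes (called agents), $E\subseteq N\times N$; it is connected, has no directed cycles, and has a unique node $s$ (the source) without incoming edges. Let $N_i^+=\{j\in N:(i,j)\in E\}$. A sink is a node with $N_i^+=\emptyset$. A path is a directed path from $s$ to a sink; $\mathcal{P}$ is the (finite) set of paths; $N_P$ is the node set of path $P$. No bottlenecks: for each agent $i$ that is neither the source nor a sink there is $P\in\mathcal{P}$ with $i\notin N_P$. $N^*=\{i\in N:N_i^+\ne\emptyset\}$ is the set of non-sink agents and $N^*_P=N_P\cap N^*$. Weights $w^*$. For $P\in\mathcal{P}$ and $i\in N$ let $v_i(P)=\frac{1}{|N_P^*|\cdot|\mathcal{P}|}$ if $i\in N_P^*$ and $v_i(P)=0$ otherwise; set $w_i^*=\sum_{P\in\mathcal{P}}v_i(P)$. *)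

(* Defs.v *)
From HB Require Import structures.
From mathcomp Require Import all_boot all_order all_algebra.

Set Implicit Arguments.
Unset Strict Implicit.
Unset Printing Implicit Defensive.

Import Order.TTheory GRing.Theory Num.Theory.

Section Networks.
Variables (T : finType) (e : rel T).

Definition out_nbrs (i : T) : {set T} := [set j | e i j].

Definition nonsinks : {set T} := [set i | out_nbrs i != set0].

Definition directed_path (s : T) (p : seq T) : bool :=
  if p is x :: q then
    [&& x == s, path e x q, uniq p & last x q \notin nonsinks]
  else false.

(* Since a path has no repeated node, its length is at most #|T|; bounded
   sequences therefore lose no path and make the set of paths finite. *)
Definition paths (s : T) : {set #|T|.-bseq T} :=
  [set P : #|T|.-bseq T | directed_path s P].

Definition path_nonsinks (P : seq T) : {set T} :=
  [set i in P] :&: nonsinks.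

(* [cycle] is the library's notion of closed walk; it includes loops, as
   [cycle e [:: x] = e x x], and the empty sequence.  Connectedness is that of
   the underlying undirected graph. *)
Record network (s : T) : Prop := Network {
  network_card : 3 <= #|T|;
  network_connected : forall i j : T, connect (fun x y => e x y || e y x) i j;
  network_acyclic : forall c : seq T, cycle e c -> c = [::];
  network_source : forall i : T, (forall j : T, ~~ e j i) <-> i = s;
  network_no_bottleneck : forall i : T, i != s -> i \in nonsinks ->
    exists2 P : #|T|.-bseq T, P \in paths s & i \notin P
}.

Definition path_weight (s : T) (P : seq T) (i : T) : rat :=
  (if i \in path_nonsinks P
   then 1 / (#|path_nonsinks P|%:R * #|paths s|%:R) else 0)%R.

Definition weight (s : T) (i : T) : rat :=
  (\sum_(P in paths s) path_weight s P i)%R.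

End Networks.

(* Random access machines over the natural numbers (three-address code, as in
   Cook and Reckhow, with multiplication and division as in Aho, Hopcroft and
   Ullman), with a read-only input tape, a write-only output tape, and running
   time measured by the logarithmic cost criterion. Under this criterion the
   machines are polynomially equivalent to Turing machines. *)
Inductive arith := Add | Sub | Mul | Div.

(* Sub is truncated, and division by 0 returns 0. *)
Definition arith_eval (o : arith) : nat -> nat -> nat :=
  match o with Add => addn | Sub => subn | Mul => muln | Div => divn end.

Inductive instr :=
  | Const (i k : nat)                (* X_i := k *)
  | Arith (o : arith) (i j k : nat)  (* X_i := X_j o X_k *)
  | LoadInd (i j : nat)              (* X_i := X_(X_j) *)
  | StoreInd (i j : nat)             (* X_(X_i) := X_j *)
  | JumpPos (i l : nat)              (* if X_i > 0 then go to line l *)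
  | Read (i : nat)                   (* X_i := next input, or 0 if none *)
  | Write (i : nat).                 (* append X_i to the output *)

Definition program := seq instr.

Record config := Config {
  pc : nat;
  mem : nat -> nat;
  inp : seq nat;
  out : seq nat
}.

Definition init_config (input : seq nat) : config :=
  Config 0 (fun=> 0) input [::].

Definition set_reg (c : config) (i v : nat) : config :=
  Config (pc c).+1 [eta mem c with i |-> v] (inp c) (out c).

Definition step (ins : instr) (c : config) : config :=
  let X := mem c in
  match ins with
  | Const i k => set_reg c i k
  | Arith o i j k => set_reg c i (arith_eval o (X j) (X k))
  | LoadInd i j => set_reg c i (X (X j))
  | StoreInd i j => set_reg c (X i) (X j)
  | JumpPos i l => Config (if 0 < X i then l else (pc c).+1) X (inp c) (out c)
  | Read i =>
      Config (pc c).+1 [eta X with i |-> head 0 (inp c)]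
             (behead (inp c)) (out c)
  | Write i => Config (pc c).+1 X (inp c) (rcons (out c) (X i))
  end.

(* The number of binary digits of x (1 for x = 0). *)
Definition bitlen (x : nat) : nat := (trunc_log 2 x).+1.

(* The total length of the register addresses and of the values handled. *)
Definition cost (ins : instr) (c : config) : nat :=
  let X := mem c in
  match ins with
  | Const i k => bitlen i + bitlen k
  | Arith _ i j k =>
      bitlen i + bitlen j + bitlen (X j) + bitlen k + bitlen (X k)
  | LoadInd i j => bitlen i + bitlen j + bitlen (X j) + bitlen (X (X j))
  | StoreInd i j => bitlen i + bitlen (X i) + bitlen j + bitlen (X j)
  | JumpPos i _ => bitlen i + bitlen (X i)
  | Read i => bitlen i + bitlen (head 0 (inp c))
  | Write i => bitlen i + bitlen (X i)
  end.

(* [exec prog c t c']: started in c, the program halts in c' after time t.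
   It halts when the program counter leaves the program. *)
Inductive exec (prog : program) : config -> nat -> config -> Prop :=
  | ExecHalt c : onth prog (pc c) = None -> exec prog c 0 c
  | ExecStep c ins t c' : onth prog (pc c) = Some ins ->
      exec prog (step ins c) t c' -> exec prog c (cost ins c + t) c'.

Definition computes (prog : program) (input : seq nat) (t : nat)
    (output : seq nat) : Prop :=
  exists2 c, exec prog (init_config input) t c & out c = output.

(* The number of nodes followed by the adjacency matrix, row by row. *)
Definition encode_graph (n : nat) (e : rel 'I_n) : seq nat :=
  n :: [seq nat_of_bool (e i j) | i <- enum 'I_n, j <- enum 'I_n].

(* The output lists, node by node, a numerator and a nonzero denominator; the
   fractions need not be in lowest terms. *)
Definition represents (n : nat) (output : seq nat) (w : 'I_n -> rat) : Prop :=
  size output = n.*2 /\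
  forall i : 'I_n,
    nth 0 output i.*2.+1 != 0 /\
    w i = ((nth 0 output i.*2)%:R / (nth 0 output i.*2.+1)%:R)%R.

(* Main.v *)
Require Import Defs.
From HB Require Import structures.
From mathcomp Require Import all_boot all_order all_algebra.
From mathcomp Require Import zify ring lra.
From Stdlib Require Import FunctionalExtensionality.

Set Implicit Arguments.
Unset Strict Implicit.
Unset Printing Implicit Defensive.

Import Order.TTheory GRing.Theory Num.Theory.

(* Walks in an acyclic graph repeat no node, so a path of length k with
   node i in position l < k is a walk of length l from s to i followed by a walk
   of length k - l from i to a sink, and it has exactly k non-sinks.  Hence
     w_i = sum_(l, m) walks l s i * exits (m + 1) i / ((l + m + 1) * |P|)
   where walks l is the l-th power of the adjacency matrix and exits sums it over
   the sinks.  With F = (n^2)! as a common denominator of the fractions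
   1 / (l + m + 1), everything is computed on integers of polynomial length; the
   weights sum to 1, so F * |P| is the sum of all the numerators and |P| need not
   be computed separately.

   The algorithm is a sequence of counted loops with straight-line bodies, the
   nested sums being flattened by writing the counter in base n.  In such a body
   the length of the numbers grows by a constant factor only, so bounding the
   memory at loop heads bounds the logarithmic cost of the whole computation. *)

(** * Weights and walks *)

Section BigTuple.
Variables (R : nmodType) (T : finType).

Lemma big_tuple_cons k (F : seq T -> R) :
  (\sum_(q : k.+1.-tuple T) F q = \sum_b \sum_(q : k.-tuple T) F (b :: q))%R.
Proof.
rewrite pair_big /= (reindex (fun p : T * k.-tuple T => [tuple of p.1 :: p.2])) //=.
exists (fun t : k.+1.-tuple T => (thead t, [tuple of behead t])) => [[b q] _|t _] /=.
  by congr pair; apply/val_inj.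
by rewrite [in RHS](tuple_eta t).
Qed.

Lemma big_tuple0 (F : seq T -> R) : (\sum_(q : 0.-tuple T) F q = F [::])%R.
Proof.
rewrite (bigD1 [tuple]) //= big1 ?addr0 // => q /negP[].
by apply/eqP; apply: tuple0.
Qed.

Lemma big_bseq n (F : seq T -> R) :
  (\sum_(P : n.-bseq T) F P = \sum_(k < n.+1) \sum_(q : k.-tuple T) F q)%R.
Proof.
rewrite sig_big_dep (reindex (@tagged_tuple_bseq n T)) //=.
exact/onW_bij/tagged_tuple_bseq_bij.
Qed.

(** The substitution k = l + m + 1 sends the triangle l < k < n to the pairs with l + m + 1 < n; the
    remaining pairs of the square contribute zero. *)
Lemma big_triangle n (f : nat -> nat -> R) :
  (forall l m, n <= l + m.+1 -> f l m.+1 = 0%R) ->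
  (\sum_(k < n) \sum_(l < k) f l (k - l)%N = \sum_(l < n) \sum_(m < n) f l m.+1)%R.
Proof.
move=> f0.
transitivity (\sum_(k < n) \sum_(l < n | (l < k)%N) f l (k - l)%N)%R.
  apply: eq_bigr => k _.
  by rewrite (big_ord_widen n (fun l => f l (k - l)%N)) // ltnW.
rewrite (exchange_big_dep xpredT) //=; apply: eq_bigr => l _.
rewrite -(big_mkord (fun k => (l < k)%N) (fun k => f l (k - l)%N)).
rewrite -(big_mkord xpredT (fun m => f l m.+1)).
have ln := ltn_ord l.
rewrite (big_cat_nat _ (n := l.+1)) //= big_nat_cond big_pred0 ?add0r; last first.
  by move=> k; lia.
rewrite [RHS](big_cat_nat _ (n := n - l.+1)) //= ?leq_subr //.
rewrite [X in (_ = _ + X)%R]big_nat_cond [X in (_ = _ + X)%R]big1 ?addr0; last first.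
  by move=> m /andP[/andP[lm _] _]; apply: f0; lia.
rewrite -{1}[l.+1]add0n big_addn big_nat_cond [RHS]big_nat_cond.
by apply: eq_big => [k|k _]; [lia | congr f; lia].
Qed.

End BigTuple.

Section Walks.
Variables (T : finType) (e : rel T).

Fixpoint walks (k : nat) (a b : T) : nat :=
  if k is k'.+1 then \sum_(c | e a c) walks k' c b else a == b.

Definition exits (k : nat) (a : T) : nat :=
  \sum_(b | b \notin nonsinks e) walks k a b.

Lemma exits0 a : exits 0 a = (a \notin nonsinks e).
Proof.
rewrite /exits /=; case: (boolP (a \in nonsinks e)) => /= aN.
  by rewrite big1 // => b; case: eqP => // <-; rewrite aN.
by rewrite (bigD1 a) //= eqxx big1 // => b /andP[_ /negPf]; rewrite eq_sym => ->.
Qed.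

Lemma exitsS k a : exits k.+1 a = \sum_(b | e a b) exits k b.
Proof. exact: exchange_big. Qed.

(** There is no [uniq] test, in contrast to [directed_path]: without it the count factors at any
    intermediate node, and acyclicity supplies uniqueness afterwards. *)
Definition complete (a : T) (q : seq T) : bool :=
  path e a q && (last a q \notin nonsinks e).

Lemma sum_complete k a : \sum_(q : k.-tuple T) complete a q = exits k a.
Proof.
elim: k a => [|k IH] a.
  by rewrite (big_tuple0 (fun q => nat_of_bool (complete a q))) exits0.
rewrite (big_tuple_cons _ (fun q => nat_of_bool (complete a q))) exitsS.
rewrite [RHS]big_mkcond; apply: eq_bigr => b _ /=.
case: ifP => eab; last by rewrite big1 // => q _; rewrite /complete /= eab.
by rewrite -IH; apply: eq_bigr => q _; rewrite /complete /= eab.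
Qed.

(** A walk is cut at position l. The induction peels off the first edge until the prescribed node is
    the starting one. *)
Lemma sum_complete_through k a l i : l <= k ->
  \sum_(q : k.-tuple T) (complete a q && (nth a (a :: q) l == i)) =
  walks l a i * exits (k - l) i.
Proof.
elim: l k a => [|l IH] k a lk.
  rewrite subn0 /=; case: eqP => [<-|_].
    by rewrite mul1n -sum_complete; apply: eq_bigr => q _; rewrite andbT.
  by rewrite big1 // => q _; rewrite andbF.
case: k lk => // k lk.
rewrite (big_tuple_cons _
  (fun q => nat_of_bool (complete a q && (nth a (a :: q) l.+1 == i)))) /=.
rewrite big_distrl [RHS]big_mkcond /=; apply: eq_bigr => b _.
case: ifP => eab; last by rewrite big1 // => q _; rewrite /complete /= eab.
rewrite subSS -IH //; apply: eq_bigr => q _; rewrite /complete /= eab /=.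
(* The index is within bounds, so the default of [nth] may change from a to b. *)
by rewrite (set_nth_default b) //= size_tuple.
Qed.

Lemma path_belast_nonsinks a q : path e a q -> {subset belast a q <= nonsinks e}.
Proof.
elim: q a => [|b q IH] a //= /andP[eab pq] x; rewrite inE => /orP[/eqP->|].
  by rewrite inE; apply/set0Pn; exists b; rewrite inE.
exact: IH.
Qed.

(** Every node of a walk except the last has an outgoing edge, and the last one is a sink. *)
Lemma complete_path_nonsinks a q : complete a q ->
  path_nonsinks e (a :: q) =i belast a q.
Proof.
case/andP=> pq lq i; rewrite !in_setI in_set lastI mem_rcons in_cons.
apply/andP/idP => [[/predU1P[->|//]]|iq].
  by move=> h; case/negP: lq.
by rewrite iq orbT; split=> //; exact: path_belast_nonsinks iq.
Qed.

Hypothesis acyclic : forall c : seq T, cycle e c -> c = [::].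

(** A return to the starting node would close a cycle. *)
Lemma path_uniq a q : path e a q -> uniq (a :: q).
Proof.
elim: q a => [|b q IH] a // /[dup] pq /andP[eab pbq]; rewrite cons_uniq IH // andbT.
apply/negP => aq; case/splitPr: aq pq => q1 q2.
rewrite cat_path /= => /and3P[p1 el _].
by have := @acyclic (a :: q1); rewrite /= rcons_path p1 el => /(_ isT).
Qed.

Lemma size_path a q : path e a q -> size q < #|T|.
Proof.
move=> /path_uniq uq; have := uniq_leq_size uq (fun x _ => mem_enum T x).
by rewrite -cardE.
Qed.

(** The product counts complete walks with l + m edges, and a walk without repeated nodes has fewer
    than [#|T|] edges. *)
Lemma walks_exits_eq0 l m a i : #|T| <= l + m -> walks l a i * exits m i = 0.
Proof.
move=> Tlm; have := @sum_complete_through (l + m) a l i (leq_addr _ _).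
rewrite addKn => <-; apply: big1 => q _.
case: (boolP (complete a q)) => //= /andP[/size_path]; rewrite size_tuple.
by rewrite ltnNge Tlm.
Qed.

Lemma directed_path_complete s q : directed_path e s (s :: q) = complete s q.
Proof.
rewrite /complete /= eqxx /=; case: (boolP (path e s q)) => //= /path_uniq /= ->.
by [].
Qed.

(** Paths are sorted by their number k of edges; the empty sequence and the sequences not starting
    at s drop out. *)
Lemma sum_directed_path (R : nmodType) s (F : seq T -> R) :
  (\sum_(P in paths e s) F P =
   \sum_(k < #|T|) \sum_(q : k.-tuple T | complete s q) F (s :: q))%R.
Proof.
rewrite big_mkcond (eq_bigr (fun P : #|T|.-bseq T =>
  if directed_path e s P then F P else 0%R)); last by move=> P _; rewrite inE.
rewrite (big_bseq _ (fun P => if directed_path e s P then F P else 0%R)).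
rewrite big_ord_recl (big_tuple0 (fun P => if directed_path e s P then F P else 0%R)).
rewrite add0r; apply: eq_bigr => k _.
rewrite (big_tuple_cons _ (fun P => if directed_path e s P then F P else 0%R)).
rewrite (bigD1 s) //= [X in (_ + X)%R]big1 ?addr0 => [|b /negPf bs].
  rewrite [RHS]big_mkcond; apply: eq_bigr => q _.
  by rewrite -directed_path_complete /= eqxx.
by rewrite big1 // => q _; rewrite bs.
Qed.

Lemma card_path_nonsinks a q : complete a q -> #|path_nonsinks e (a :: q)| = size q.
Proof.
move=> cq; rewrite (eq_card (complete_path_nonsinks cq)).
have /andP[/path_uniq] := cq; rewrite lastI rcons_uniq => /andP[_ uq] _.
by rewrite (card_uniqP uq) size_belast.
Qed.

(** As no node repeats, at most one position holds i; the range l < k leaves out the final sink. *)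
Lemma mem_path_nonsinks k a q i : size q = k -> complete a q ->
  (i \in path_nonsinks e (a :: q)) = \sum_(l < k) (nth a (a :: q) l == i) :> nat.
Proof.
move=> <- cq; rewrite complete_path_nonsinks //.
have /andP[/path_uniq] := cq; rewrite lastI rcons_uniq => /andP[_ uq] _.
rewrite -(count_uniq_mem _ uq) -sum1_count big_mkcond (big_nth a) big_mkord.
rewrite size_belast; apply: eq_bigr => l _.
by rewrite nth_rcons size_belast ltn_ord /=; case: eqP.
Qed.

Lemma weight_walks s i :
  weight e s i = (\sum_(l < #|T|) \sum_(m < #|T|)
    (walks l s i * exits m.+1 i)%N%:R / ((l + m.+1)%N%:R * #|paths e s|%:R))%R.
Proof.
(* The second argument is k - l, the form that [big_triangle] expects. *)
pose f l m : rat :=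
  ((walks l s i * exits m i)%N%:R / ((l + m)%N%:R * #|paths e s|%:R))%R.
rewrite -(big_triangle (f := f)); last first.
  by move=> l m lm; rewrite /f walks_exits_eq0 ?mul0r.
rewrite /weight (sum_directed_path s (fun P => path_weight e s P i)).
apply: eq_bigr => k _.
transitivity (\sum_(q : k.-tuple T) \sum_(l < k)
   (complete s q && (nth s (s :: q) l == i))%:R / (k%:R * #|paths e s|%:R) : rat)%R.
  rewrite big_mkcond; apply: eq_bigr => q _.
  case: ifP => cq; last by rewrite big1 // => l _; rewrite mul0r.
  rewrite -mulr_suml -natr_sum /= -(mem_path_nonsinks _ (size_tuple q) cq).
  rewrite /path_weight card_path_nonsinks // size_tuple.
  by case: ifP => _; rewrite ?mul0r.
rewrite exchange_big; apply: eq_bigr => l _.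
rewrite -mulr_suml -natr_sum sum_complete_through; last exact/ltnW.
by rewrite /f subnKC // ltnW.
Qed.

(** A walk is extended as long as it ends in a non-sink; k bounds the number of extensions left,
    since walks have fewer than [#|T|] edges. *)
Lemma exists_complete a : exists q, complete a q.
Proof.
suff: forall k q, path e a q -> #|T| <= size q + k -> exists q', complete a q'.
  by move=> /(_ #|T| [::] isT (leqnn _)).
elim=> [|k IH] q pq; first by rewrite addn0 leqNgt (size_path pq).
move=> qk; case: (boolP (last a q \in nonsinks e)) => lq.
  move: lq; rewrite inE => /set0Pn[b]; rewrite inE => eb.
  by apply: (IH (rcons q b)); rewrite ?rcons_path ?pq // size_rcons addSnnS.
by exists q; rewrite /complete pq.
Qed.

End Walks.

Section Network.
Variables (T : finType) (e : rel T) (s : T).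
Hypothesis net : network e s.

(** Connectedness gives an edge between s and some node, and this edge cannot enter s. *)
Lemma network_source_nonsink : s \in nonsinks e.
Proof.
have [j js] : exists j, j != s.
  have /card_gt0P[j] : 0 < #|predC1 s|.
    by rewrite cardC1; have := network_card net; lia.
  by exists j.
have /connectP[[|x p] /=] := network_connected net s j.
  by move=> _ js'; rewrite js' eqxx in js.
case/andP => /orP[esx|exs] _ _.
  by rewrite inE; apply/set0Pn; exists x; rewrite inE.
by have := (network_source net s).2 erefl x; rewrite exs.
Qed.

Lemma card_paths_gt0 : 0 < #|paths e s|.
Proof.
have acy := network_acyclic net; have [q cq] := exists_complete acy s.
have sz : size (s :: q) <= #|T| by case/andP: cq => /(size_path acy).
apply/card_gt0P; exists (Bseq sz).
by rewrite inE /= -(directed_path_complete acy) in cq *.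
Qed.

(** Each path shares its portion 1/|P| equally among its non-sinks, of which there is at least one,
    namely the source. *)
Lemma sum_weight : (\sum_i weight e s i = 1 :> rat)%R.
Proof.
have acy := network_acyclic net; have P0 := card_paths_gt0.
rewrite exchange_big /= (eq_bigr (fun=> #|paths e s|%:R^-1)%R); last first.
  move=> P; rewrite inE; case: (bseqval P) => // x q /[dup] /andP[/eqP-> _].
  rewrite (directed_path_complete acy) => cq.
  rewrite -big_mkcond sumr_const card_path_nonsinks //.
  have q0 : 0 < size q.
    case: q cq => //; rewrite /complete /= => /negP[].
    exact: network_source_nonsink.
  rewrite -[LHS]mulr_natl div1r invfM mulrA divff ?mul1r //.
  by rewrite pnatr_eq0 -lt0n.
by rewrite sumr_const -[LHS]mulr_natl divff // pnatr_eq0 -lt0n.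
Qed.

End Network.

(** * Acyclic tournaments *)

Section Tournament.
Variable k : nat.
Local Notation n := k.+3.

Definition tournament : rel 'I_n := fun i j => i < j.

(** Since [enum] is increasing, this is the path through both end nodes and the inner nodes of A. *)
Definition selection (A : {set 'I_n}) : seq 'I_n :=
  [seq i <- enum 'I_n | [|| i == ord0, i == ord_max | i \in A]].

Lemma size_selection A : size (selection A) <= #|'I_n|.
Proof. by rewrite size_filter (leq_trans (count_size _ _)) // -cardE. Qed.

Lemma enum_ord_head_last :
  exists q, enum 'I_n = ord0 :: rcons q (ord_max : 'I_n).
Proof.
exists [seq lift ord0 (widen_ord (leqnSn k.+1) i) | i <- enum 'I_k.+1].
rewrite [LHS]enum_ordSl (enum_ordSr k.+1) map_rcons -map_comp.
by congr (_ :: rcons _ _); apply/val_inj.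
Qed.

Lemma mem_nonsinks_tournament (i : 'I_n) : (i \in nonsinks tournament) = (i < n.-1).
Proof.
rewrite inE; apply/set0Pn/idP => [[j]|lt_i].
  by rewrite inE /tournament; have := ltn_ord j; lia.
by exists ord_max; rewrite inE.
Qed.

Lemma directed_path_selection A : directed_path tournament ord0 (selection A).
Proof.
have srt : sorted tournament (selection A).
  apply: sorted_filter; first by move=> y x z; apply: ltn_trans.
  by have := iota_ltn_sorted 0 n; rewrite -val_enum_ord sorted_map.
have uq : uniq (selection A) by rewrite filter_uniq ?enum_uniq.
move: srt uq; rewrite /selection; have [q ->] := enum_ord_head_last.
rewrite /= filter_rcons eqxx orbT => srt uq.
rewrite srt last_rcons mem_nonsinks_tournament /= ltnn andbT.
exact: uq.
Qed.

Lemma network_tournament : network tournament ord0.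
Proof.
have trans : transitive tournament by move=> y x z; apply: ltn_trans.
split.
- by rewrite card_ord.
- move=> i j; have [->|ij] := eqVneq i j; first exact: connect0.
  by apply: connect1; rewrite /tournament -neq_ltn.
- case=> // x q; rewrite /= rcons_path => /andP[pq lx].
  have := order_path_min trans (_ : path tournament x (rcons q x)).
  by rewrite rcons_path pq lx => /(_ isT) /allP /(_ x);
    rewrite mem_rcons inE eqxx /tournament ltnn => /(_ isT).
- move=> i; split=> [noin|-> j]; last by [].
  apply/val_inj => /=; apply/eqP; rewrite eqn0Ngt; exact: (noin ord0).
- move=> i i0; rewrite mem_nonsinks_tournament => ilt.
  (* The single edge from the first node to the last avoids all inner nodes. *)
  exists (Bseq (size_selection set0)).
    by rewrite inE directed_path_selection.
  rewrite /selection mem_filter inE orbF negb_and negb_or i0 /=.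
  by apply/orP; left; apply: contraTneq ilt => ->; rewrite /= ltnn.
Qed.

(** A set of inner nodes can be recovered from its selection, so the subsets of the k + 1 inner
    nodes give distinct paths. *)
Lemma card_paths_tournament : 2 ^ k.+1 <= #|paths tournament ord0|.
Proof.
pose M : {set 'I_n} := [set~ ord0] :\ ord_max.
have cM : #|M| = k.+1.
  have := cardsD1 (ord_max : 'I_n) [set~ ord0]; rewrite cardsC1 card_ord !inE /=.
  by rewrite -/M add1n => /succn_inj /esym.
pose f (A : {set 'I_n}) : #|'I_n|.-bseq 'I_n := Bseq (size_selection A).
apply: (@leq_trans #|powerset M|); first by rewrite card_powerset cM.
rewrite -(card_in_imset (f := f)).
  apply: subset_leq_card; apply/subsetP => _ /imsetP[A _ ->].
  by rewrite inE directed_path_selection.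
move=> A B; rewrite !inE => /subsetP AM /subsetP BM /(congr1 val) /= AB.
apply/setP => i; have [iM|iM] := boolP (i \in M).
  have := congr1 (fun s => i \in s) AB; rewrite /= [LHS]mem_filter [RHS]mem_filter !mem_enum !andbT.
  by move: iM; rewrite !inE => /andP[/negPf-> /negPf->].
by rewrite (contraNF (AM i) iM) (contraNF (BM i) iM).
Qed.

End Tournament.

(** The base 5/4 is chosen for (5/4)^3 = 125/64 <= 2, which absorbs the two extra factors; each
    further step uses 5/4 <= 2. *)
Lemma five_quarters_expr (R : realFieldType) (m : nat) :
  ((5%:R / 4%:R) ^+ m.+3 <= 2%:R ^+ m.+1 :> R)%R.
Proof.
have a2 : (5%:R / 4%:R <= 2%:R :> R)%R by lra.
have a0 : (0 <= 5%:R / 4%:R :> R)%R by lra.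
elim: m => [|m IH]; first by rewrite !exprS expr0; lra.
by rewrite exprS [leRHS]exprS; apply: ler_pM; rewrite ?exprn_ge0.
Qed.

Lemma exponentially_many_paths : exists a : rat, (1 < a)%R /\
  forall m : nat, exists (n : nat) (e : rel 'I_n) (s : 'I_n),
    [/\ m <= n, network e s & (a ^+ n <= #|paths e s|%:R)%R].
Proof.
exists (5%:R / 4%:R)%R; split; first by lra.
move=> m; exists m.+3, (@tournament m), ord0; split.
- by rewrite -addn3 leq_addr.
- exact: network_tournament.
- apply: le_trans (five_quarters_expr _ m) _.
  by rewrite -natrX ler_nat card_paths_tournament.
Qed.

(** * Cost of straight-line code *)

Definition straight (ins : instr) := if ins is JumpPos _ _ then false else true.

Definition srun (b : seq instr) (c : config) : config :=
  foldl (fun c ins => step ins c) c b.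

Fixpoint scost (b : seq instr) (c : config) : nat :=
  if b is ins :: b' then cost ins c + scost b' (step ins c) else 0.

Lemma srun_cat b1 b2 c : srun (b1 ++ b2) c = srun b2 (srun b1 c).
Proof. exact: foldl_cat. Qed.

Lemma pc_step ins c : straight ins -> pc (step ins c) = (pc c).+1.
Proof. by case: ins. Qed.

(** The rest of the run appears as a premise, so that successive blocks chain. The induction moves
    instructions from the block into [pre]. *)
Lemma exec_straight b pre post c t c' :
  all straight b -> pc c = size pre ->
  exec (pre ++ b ++ post) (srun b c) t c' ->
  exec (pre ++ b ++ post) c (scost b c + t) c'.
Proof.
elim: b pre c => [|ins b IH] pre c //= /andP[s_ins s_b] pc_c ex.
rewrite -addnA; apply: ExecStep.
  by rewrite pc_c -cat_cons onth_cat ltnn subnn.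
rewrite -cat_rcons; apply: IH => //; last by rewrite cat_rcons.
by rewrite size_rcons pc_step // pc_c.
Qed.

(** Jump targets are left out because [cost] does not charge for them. *)
Definition constants (ins : instr) : seq nat :=
  match ins with
  | Const i k => [:: i; k]
  | Arith _ i j k => [:: i; j; k]
  | LoadInd i j => [:: i; j]
  | StoreInd i j => [:: i; j]
  | JumpPos i _ => [:: i]
  | Read i => [:: i]
  | Write i => [:: i]
  end.

(** The output is not constrained: it is never read back. *)
Definition bounded (V : nat) (c : config) : Prop :=
  (forall a, Defs.mem c a <= V) /\ all (leq^~ V) (inp c).

Lemma leq_bitlen x y : x <= y -> bitlen x <= bitlen y.
Proof. by move=> xy; rewrite /bitlen ltnS leq_trunc_log. Qed.

(** If x < 2^b then x^2 < 2^(2b). *)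
Lemma bitlen_sqr x : 0 < x -> bitlen (x * x) <= 2 * bitlen x.
Proof.
move=> x0; rewrite /bitlen; set k := trunc_log 2 x.
have lt_x: x < 2 ^ k.+1 by apply: trunc_log_ltn.
have lt_xx : x * x < 2 ^ (2 * k.+1).
  by rewrite mulnC expnM -mulnn ltn_mul.
have := trunc_logP (isT : 1 < 2) (_ : 0 < x * x).
rewrite muln_gt0 x0 => /(_ isT) le.
by rewrite -(ltn_exp2l _ _ (isT : 1 < 2)) (leq_ltn_trans le).
Qed.

Lemma bounded_head V c : bounded V c -> head 0 (inp c) <= V.
Proof. by case=> _; case: (inp c) => //= x s /andP[]. Qed.

Lemma cost_le V ins c :
  bounded V c -> all (leq^~ V) (constants ins) -> cost ins c <= 5 * bitlen V.
Proof.
move=> bV; have hd := leq_bitlen (bounded_head bV); case: (bV) => mV _.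
have bm a : bitlen (Defs.mem c a) <= bitlen V by apply: leq_bitlen.
have b k : k <= V -> bitlen k <= bitlen V by apply: leq_bitlen.
case: ins => [i k|o i j k|i j|i j|i l|i|i] /=; rewrite ?andbT.
- by move=> /andP[/b ? /b ?]; lia.
- move=> /and3P[/b ? /b ? /b ?]; have := bm j; have := bm k; lia.
- move=> /andP[/b ? /b ?]; have := bm j; have := bm (Defs.mem c j); lia.
- move=> /andP[/b ? /b ?]; have := bm i; have := bm j; lia.
- move=> /b ?; have := bm i; lia.
- move=> /b ?; lia.
- move=> /b ?; have := bm i; lia.
Qed.

Lemma arith_eval_le V o x y :
  1 < V -> x <= V -> y <= V -> arith_eval o x y <= V * V.
Proof.
move=> V1 xV yV; case: o => /=.
- by nia.
- by nia.
- by apply: leq_mul.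
- by apply: leq_trans (leq_div _ _) _; nia.
Qed.

Lemma bounded_step V ins c : 1 < V ->
  bounded V c -> all (leq^~ V) (constants ins) -> bounded (V * V) (step ins c).
Proof.
move=> V1 bV; have hd := bounded_head bV; case: bV => mV iV.
have VV : V <= V * V by nia.
have w x : x <= V -> x <= V * V by move=> /leq_trans; apply.
have iVV : all (leq^~ (V * V)) (inp c) by apply: sub_all iV => x /w.
case: ins => [i k|o i j k|i j|i j|i l|i|i] /=; rewrite ?andbT.
- by move=> /andP[_ kV]; split=> //= a; case: eqP => // _; apply: w.
- move=> _; split=> //= a; case: eqP => // _; last exact: w.
  exact: arith_eval_le.
- by move=> _; split=> //= a; case: eqP => // _; apply: w.
- by move=> _; split=> //= a; case: eqP => // _; apply: w.
- by move=> _; split=> //= a; apply: w.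
- move=> _; split=> //=; last by case: (inp c) iVV => //= ? ? /andP[].
  by move=> a; case: eqP => // _; apply: w.
- by move=> _; split=> //= a; apply: w.
Qed.

(** The 5 pays for the first instruction; the factor 2 reflects the doubled bit lengths met by the
    others. *)
Fixpoint block_factor (k : nat) : nat :=
  if k is k'.+1 then 5 + 2 * block_factor k' else 0.

Lemma leq_block_factor k l : k <= l -> block_factor k <= block_factor l.
Proof. elim: k l => [|k IH] [|l] //= kl; have := IH l kl; lia. Qed.

(* One instruction at most squares the bound on the memory, so a block of
   constant length multiplies bit lengths by a constant only. *)
Lemma scost_le V b c : 1 < V -> bounded V c ->
  all (fun ins => all (leq^~ V) (constants ins)) b ->
  scost b c <= block_factor (size b) * bitlen V.
Proof.
elim: b V c => [|ins b IH] V c //= V1 bV /andP[iV bbV].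
have := cost_le bV iV.
have V1' : 1 < V * V by nia.
have := IH _ _ V1' (bounded_step V1 bV iV).
have -> : all (fun ins => all (leq^~ (V * V)) (constants ins)) b.
  apply: sub_all bbV => j; apply: sub_all => x xV; nia.
move=> /(_ isT); have := bitlen_sqr (ltnW V1).
set K := block_factor _; move=> h1 h2 h3; nia.
Qed.

(** * A language of counted loops *)

Inductive expr := Cst of nat | Op of arith & expr & expr | Get of nat & expr.

Inductive cmd :=
  | Put of nat & expr & expr
  | In of nat & expr
  | Out of expr.

Record state := State {
  arr : nat -> nat -> nat;
  sinp : seq nat;
  sout : seq nat
}.

Fixpoint eval (g : nat -> nat -> nat) (e : expr) : nat :=
  match e with
  | Cst k => k
  | Op o a b => arith_eval o (eval g a) (eval g b)
  | Get r x => g r (eval g x)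
  end.

Definition upd (g : nat -> nat -> nat) r x v : nat -> nat -> nat :=
  fun r' x' => if (r' == r) && (x' == x) then v else g r' x'.

Definition den (c : cmd) (s : state) : state :=
  let g := arr s in
  match c with
  | Put r x v => State (upd g r (eval g x) (eval g v)) (sinp s) (sout s)
  | In r x =>
      State (upd g r (eval g x) (head 0 (sinp s))) (behead (sinp s)) (sout s)
  | Out v => State g (sinp s) (rcons (sout s) (eval g v))
  end.

Definition dens (cs : seq cmd) (s : state) : state :=
  foldl (fun s c => den c s) s cs.

(* The arrays 0, ..., 6 are interleaved in memory; the residue 7 holds the
   stack of intermediate values, which is empty (zero) between commands. *)
Definition cell (r x : nat) := x * 8 + r.

Definition tmp := cell 7.

Definition flat (g : nat -> nat -> nat) (a : nat) : nat :=
  if a %% 8 == 7 then 0 else g (a %% 8) (a %/ 8).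

Definition conf (p : nat) (s : state) : config :=
  Config p (flat (arr s)) (sinp s) (sout s).

Fixpoint wf_expr (e : expr) : bool :=
  match e with
  | Cst _ => true
  | Op _ a b => wf_expr a && wf_expr b
  | Get r x => (r < 7) && wf_expr x
  end.

Definition wf_cmd (c : cmd) : bool :=
  match c with
  | Put r x v => [&& r < 7, wf_expr x & wf_expr v]
  | In r x => (r < 7) && wf_expr x
  | Out v => wf_expr v
  end.

(** * Compilation of expressions and commands *)

Definition to_addr (r d : nat) : seq instr :=
  [:: Const (tmp d.+1) 8; Arith Mul (tmp d) (tmp d) (tmp d.+1);
      Const (tmp d.+1) r; Arith Add (tmp d) (tmp d) (tmp d.+1);
      Const (tmp d.+1) 0].

(** The stack depth d is known at compile time. The value is left in [tmp d], and all higher slots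
    are zero again. *)
Fixpoint comp_expr (e : expr) (d : nat) : seq instr :=
  match e with
  | Cst k => [:: Const (tmp d) k]
  | Op o a b =>
      comp_expr a d ++ comp_expr b d.+1 ++
      [:: Arith o (tmp d) (tmp d) (tmp d.+1); Const (tmp d.+1) 0]
  | Get r x =>
      (comp_expr x d ++ to_addr r d) ++ [:: LoadInd (tmp d) (tmp d)]
  end.

Definition comp_cmd (c : cmd) : seq instr :=
  match c with
  | Put r x v =>
      (comp_expr x 0 ++ to_addr r 0) ++ comp_expr v 1 ++
      [:: StoreInd (tmp 0) (tmp 1); Const (tmp 0) 0; Const (tmp 1) 0]
  | In r x =>
      (comp_expr x 0 ++ to_addr r 0) ++
      [:: Read (tmp 1); StoreInd (tmp 0) (tmp 1);
          Const (tmp 0) 0; Const (tmp 1) 0]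
  | Out v => comp_expr v 0 ++ [:: Write (tmp 0); Const (tmp 0) 0]
  end.

Definition comp_cmds (cs : seq cmd) : seq instr := flatten (map comp_cmd cs).

Lemma eq_tmp d d' : (tmp d == tmp d') = (d == d').
Proof. by rewrite /tmp /cell; apply/eqP/eqP; lia. Qed.

Lemma eq_tmpS d : (tmp d == tmp d.+1) = false.
Proof. by rewrite eq_tmp; lia. Qed.

Lemma eq_tmpSn d : (tmp d.+1 == tmp d) = false.
Proof. by rewrite eq_tmp; lia. Qed.

Lemma eq_cell_tmp r x d : r < 7 -> (cell r x == tmp d) = false.
Proof. by move=> r7; rewrite /tmp /cell; lia. Qed.

Definition agrees (g : nat -> nat -> nat) (m : nat -> nat) :=
  forall r x, r < 7 -> m (cell r x) = g r x.

Lemma agrees_tmp g m d v : agrees g m -> agrees g [eta m with tmp d |-> v].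
Proof. by move=> gm r x r7 /=; rewrite eq_cell_tmp // gm. Qed.

Lemma srun_to_addr r d p m i o : (forall d', d < d' -> m (tmp d') = 0) ->
  srun (to_addr r d) (Config p m i o) =
  Config (p + size (to_addr r d)) [eta m with tmp d |-> cell r (m (tmp d))] i o.
Proof.
move=> m0; rewrite /to_addr /srun /= /set_reg /=; congr Config; first by rewrite !addnS addn0.
apply: functional_extensionality => a /=.
rewrite !eqxx !eq_tmpS.
case: (a =P tmp d.+1) => [->|]; first by rewrite eq_tmpSn m0.
by case: (a == tmp d).
Qed.

(** The final memory is given exactly, not up to scratch registers. This works because every slot
    above d is cleared after use. *)
Lemma srun_comp_expr g e d p m i o :
  wf_expr e -> agrees g m -> (forall d', d < d' -> m (tmp d') = 0) ->
  srun (comp_expr e d) (Config p m i o) =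
  Config (p + size (comp_expr e d)) [eta m with tmp d |-> eval g e] i o.
Proof.
elim: e d p m => [k|op a IHa b IHb|r x IH] d p m /=.
- by move=> _ _ _; rewrite /srun /= /set_reg /= addn1.
- move=> /andP[wa wb] gm m0; rewrite srun_cat IHa // srun_cat IHb //.
  + rewrite /srun /= /set_reg /=; congr Config.
      by rewrite !size_cat /=; lia.
    apply: functional_extensionality => y /=; rewrite !eqxx !eq_tmpS.
    case: (y =P tmp d.+1) => [->|]; first by rewrite eq_tmpSn m0.
    by case: (y == tmp d).
  + exact: agrees_tmp.
  + by move=> d' dd' /=; rewrite eq_tmp m0; [case: eqP => // ?|]; lia.
- move=> /andP[r7 wx] gm m0; rewrite !srun_cat IH // srun_to_addr /=.
    rewrite /srun /= /set_reg /=; congr Config.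
      by rewrite !size_cat /=; lia.
    apply: functional_extensionality => y /=.
    rewrite !eqxx eq_cell_tmp // gm //; case: (y == tmp d) => //.
  by move=> d' dd'; rewrite eq_tmp m0; [case: eqP => // ?|]; lia.
Qed.

Lemma agrees_flat g : agrees g (flat g).
Proof.
move=> r x r7; rewrite /flat /cell.
have -> : (x * 8 + r) %% 8 = r by lia.
have -> : (x * 8 + r) %/ 8 = x by lia.
by case: eqP => // r7'; lia.
Qed.

Lemma flat_tmp g d : flat g (tmp d) = 0.
Proof. by rewrite /flat /tmp /cell; have -> : (d * 8 + 7) %% 8 = 7 by lia. Qed.

Lemma flat_upd g r x v a : r < 7 ->
  flat (upd g r x v) a = if a == cell r x then v else flat g a.
Proof.
move=> r7; rewrite /flat /upd /cell.
have -> : (a %% 8 == r) && (a %/ 8 == x) = (a == x * 8 + r) by lia.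
by case: (a =P x * 8 + r) => [->|_] //; case: eqP => //; lia.
Qed.

(** Clearing slots 0 and 1 empties the stack, so the memory is again the image of a state. *)
Lemma srun_comp_cmd c p s : wf_cmd c ->
  srun (comp_cmd c) (conf p s) = conf (p + size (comp_cmd c)) (den c s).
Proof.
case: s => g i o; have fg := @agrees_flat g; have f0 := flat_tmp g.
case: c => [r x v|r x|v] /=.
- move=> /and3P[r7 wx wv].
  rewrite !srun_cat (srun_comp_expr _ _ _ wx fg) // srun_to_addr /=; last first.
    by move=> d' ?; rewrite f0 eq_tmp; case: eqP => // ?; lia.
  rewrite (srun_comp_expr _ _ _ wv (g := g)); first last.
  + by move=> d' ? /=; rewrite f0 !eq_tmp; case: eqP => // ?; lia.
  + by do 2!apply: agrees_tmp.
  rewrite /srun /= /set_reg /= /conf /=; congr Config.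
    by rewrite !size_cat /=; lia.
  apply: functional_extensionality => y /=.
  rewrite flat_upd //.
  case: (y =P tmp 1) => [->|_]; first by rewrite eq_sym eq_cell_tmp // f0.
  by case: (y =P tmp 0) => [->|_]; first by rewrite eq_sym eq_cell_tmp // f0.
- move=> /andP[r7 wx].
  rewrite !srun_cat (srun_comp_expr _ _ _ wx fg) // srun_to_addr /=; last first.
    by move=> d' ?; rewrite f0 eq_tmp; case: eqP => // ?; lia.
  rewrite /srun /= /set_reg /= /conf /=; congr Config.
    by rewrite !size_cat /=; lia.
  apply: functional_extensionality => y /=.
  rewrite flat_upd //.
  case: (y =P tmp 1) => [->|_]; first by rewrite eq_sym eq_cell_tmp // f0.
  by case: (y =P tmp 0) => [->|_]; first by rewrite eq_sym eq_cell_tmp // f0.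
- move=> wv.
  rewrite srun_cat (srun_comp_expr _ _ _ wv fg) //.
  rewrite /srun /= /set_reg /= /conf /=; congr Config.
  + by rewrite !size_cat /=; lia.
  + apply: functional_extensionality => y /=.
    by case: (y =P tmp 0) => [->|].
Qed.

Lemma srun_comp_cmds cs p s : all wf_cmd cs ->
  srun (comp_cmds cs) (conf p s) = conf (p + size (comp_cmds cs)) (dens cs s).
Proof.
elim: cs p s => [|c cs IH] p s /=; first by rewrite addn0.
move=> /andP[wc wcs].
by rewrite /comp_cmds /= srun_cat srun_comp_cmd // IH // size_cat addnA.
Qed.

Lemma straight_comp_expr e d : all straight (comp_expr e d).
Proof.
elim: e d => [k|o a IHa b IHb|r x IH] d //=; rewrite /to_addr ?all_cat ?IHa ?IHb //=.
by rewrite IH.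
Qed.

Lemma straight_comp_cmd c : all straight (comp_cmd c).
Proof. by case: c => [r x v|r x|v] /=; rewrite /to_addr !all_cat /= ?straight_comp_expr. Qed.

Lemma straight_comp_cmds cs : all straight (comp_cmds cs).
Proof.
by elim: cs => //= c cs IH; rewrite /comp_cmds /= all_cat straight_comp_cmd.
Qed.

(* [(x, cs)] executes cs for the values 0, 1, ..., x - 1 of the counter, which
   is cell 0 of array 0; at least one iteration is performed.  Cell 1 holds the
   number of iterations that remain. *)
Definition loop := (expr * seq cmd)%type.

Definition counter := Get 0 (Cst 0).

Definition reset : seq cmd := [:: Put 0 (Cst 0) (Cst 0)].

(** The number of remaining iterations is recomputed after the body, so the bound need not be
    available before the first pass. *)
Definition iteration (l : loop) : seq cmd :=
  l.2 ++ [:: Put 0 (Cst 0) (Op Add counter (Cst 1));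
             Put 0 (Cst 1) (Op Defs.Sub l.1 counter)].

Definition wf_loop (l : loop) := wf_expr l.1 && all wf_cmd l.2.

(** Jump targets are absolute, hence the offset; the jump returns to just after the reset. *)
Definition comp_loop (off : nat) (l : loop) : seq instr :=
  comp_cmds reset ++ comp_cmds (iteration l) ++
  [:: JumpPos (cell 0 1) (off + size (comp_cmds reset))].

Fixpoint comp_loops (off : nat) (ls : seq loop) : program :=
  if ls is l :: ls' then
    comp_loop off l ++ comp_loops (off + size (comp_loop off l)) ls'
  else [::].

Definition run_loop (l : loop) (N : nat) (s : state) : state :=
  iter N (dens (iteration l)) (dens reset s).

Definition sbounded (V : nat) (s : state) : Prop :=
  (forall r x, r < 7 -> arr s r x <= V) /\ all (leq^~ V) (sinp s).

Lemma bounded_conf V p s : sbounded V s -> bounded V (conf p s).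
Proof.
case=> aV iV; split=> //= a; rewrite /flat; case: eqP => // /eqP a7.
by apply: aV; lia.
Qed.

(** The last clause makes the closing jump fail for the first time after iteration N. The state left
    by that iteration is bounded only through the requirement of the next loop. *)
Definition loop_ok V (l : loop) (N : nat) (s : state) : Prop :=
  [/\ 0 < N, sbounded V s,
      forall t, t < N -> sbounded V (run_loop l t s)
    & forall t, t < N -> (0 < arr (run_loop l t.+1 s) 0 1) = (t.+1 < N)].

(** The number T counts executed blocks: the iterations of each loop and one more for its reset. *)
Inductive runs V : seq loop -> state -> nat -> state -> Prop :=
  | RunsNil s : runs V [::] s 0 s
  | RunsCons l ls s N T s' : loop_ok V l N s ->
      runs V ls (run_loop l N s) T s' -> runs V (l :: ls) s (N.+1 + T) s'.

Lemma dens_cat cs1 cs2 s : dens (cs1 ++ cs2) s = dens cs2 (dens cs1 s).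
Proof. exact: foldl_cat. Qed.

Lemma exec_block pre cs post p s t c' V :
  all wf_cmd cs -> p = size pre -> 1 < V -> sbounded V s ->
  all (fun ins => all (leq^~ V) (constants ins)) (comp_cmds cs) ->
  exec (pre ++ comp_cmds cs ++ post)
    (conf (p + size (comp_cmds cs)) (dens cs s)) t c' ->
  exists2 t', exec (pre ++ comp_cmds cs ++ post) (conf p s) (t' + t) c'
    & t' <= block_factor (size (comp_cmds cs)) * bitlen V.
Proof.
move=> wcs pp V1 sV kV ex; exists (scost (comp_cmds cs) (conf p s)).
  apply: exec_straight => //; first exact: straight_comp_cmds.
  by rewrite srun_comp_cmds.
by apply: scost_le => //; apply: bounded_conf.
Qed.

Lemma exec_loop pre l post V N s t c' :
  wf_loop l -> 1 < V -> loop_ok V l N s ->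
  all (fun ins => all (leq^~ V) (constants ins)) (comp_loop (size pre) l) ->
  let code := comp_loop (size pre) l in
  exec (pre ++ code ++ post) (conf (size pre + size code) (run_loop l N s)) t c' ->
  exists2 t', exec (pre ++ code ++ post) (conf (size pre) s) (t' + t) c'
    & t' <= N.+1 * ((block_factor (size code) + 2) * bitlen V).
Proof.
move=> /andP[wx wcs] V1 [N0 sV stV test].
rewrite /comp_loop; set R := comp_cmds reset; set I := comp_cmds (iteration l).
set J := JumpPos _ _; rewrite all_cat => /andP[RV]; rewrite all_cat => /andP[IV JV].
have {}JV : cell 0 1 <= V by move: JV; rewrite /= !andbT.
set P := pre ++ (R ++ I ++ [:: J]) ++ post => ex.
have szP : size (R ++ I ++ [:: J]) = size R + size I + 1 by rewrite !size_cat addnA.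
set K := block_factor _; set B := (K + 2) * _.
have wi : all wf_cmd (iteration l) by rewrite all_cat /= wx wcs.
have PI : P = (pre ++ R) ++ I ++ ([:: J] ++ post) by rewrite /P -!catA.
have PR : P = pre ++ R ++ (I ++ [:: J] ++ post) by rewrite /P -!catA.
(* Here t0 iterations are done and k remain. *)
have loop k t0 : 0 < k -> t0 + k = N ->
    exists2 t', exec P (conf (size pre + size R) (run_loop l t0 s)) (t' + t) c'
      & t' <= k * B.
  elim: k t0 => // k IH t0 _ t0k.
  have t0N : t0 < N by lia.
  have sJ : exists2 t',
      exec P (conf (size pre + size R + size I) (run_loop l t0.+1 s)) (t' + t) c'
      & t' <= 2 * bitlen V + k * B.
    set v := arr (run_loop l t0.+1 s) 0 1.
    (* After the last iteration no bound on the state is available, but then the tested cell is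
       0. *)
    have vV : bitlen v <= bitlen V.
      apply: leq_bitlen; have := test _ t0N; rewrite -/v.
      by case: (ltnP t0.+1 N) => [/stV[/(_ 0 1 isT)]|]; last lia.
    have fv : flat (arr (run_loop l t0.+1 s)) (cell 0 1) = v.
      exact: agrees_flat.
    have onJ : onth P (size pre + size R + size I) = Some J.
      rewrite PI onth_cat size_cat ltnNge leq_addr /= addKn.
      by rewrite onth_cat ltnn subnn.
    set q := conf _ _.
    have cJ : cost J q <= 2 * bitlen V.
      rewrite /cost /q /= fv; have := leq_bitlen JV; lia.
    have next : step J q = conf (if t0.+1 < N then size pre + size R
        else size pre + size (R ++ I ++ [:: J])) (run_loop l t0.+1 s).
      rewrite /step /q /= fv test //; congr Config.
      by case: ifP => // _; move: szP => /= ->; lia.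
    case: (posnP k) => [k0|k0].
      exists (cost J q); last by lia.
      apply: (@ExecStep P q J _ c' onJ); rewrite next ifF; last by lia.
      by rewrite (_ : t0.+1 = N) //; lia.
    have [|t' ex' t'B] := IH t0.+1 k0; first by lia.
    exists (cost J q + t'); last by lia.
    rewrite -addnA; apply: (@ExecStep P q J _ c' onJ); rewrite next ifT //.
    by lia.
  case: sJ => t1 ex1 t1B; rewrite PI in ex1.
  have [|t2 ex2 t2B] := exec_block (V := V) wi _ V1 (stV _ t0N) IV ex1.
    by rewrite size_cat.
  exists (t2 + t1); first by rewrite PI -addnA.
  have /leq_block_factor : size I <= size (R ++ I ++ [:: J]) by rewrite szP; lia.
  by rewrite -/K /B; move: t1B t2B; rewrite /B -/I; nia.
have [t1 ex1 t1B] := loop N 0 N0 (erefl _).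
rewrite PR in ex1.
have [|t2 ex2 t2B] := exec_block (V := V) (isT : all wf_cmd reset) _ V1 sV RV ex1.
  by [].
exists (t2 + t1); first by rewrite -addnA PR.
have /leq_block_factor : size R <= size (R ++ I ++ [:: J]) by rewrite szP; lia.
by rewrite -/K; move: t1B t2B; rewrite /B -/R; nia.
Qed.

(** Each loop already passed joins the prefix [pre]; K bounds the whole code, so one cost factor
    serves every loop. *)
Lemma exec_runs V K ls s T s' : runs V ls s T s' ->
  forall pre post t c' code, 1 < V -> all wf_loop ls ->
  code = comp_loops (size pre) ls ->
  all (fun ins => all (leq^~ V) (constants ins)) code ->
  size code <= K ->
  exec (pre ++ code ++ post) (conf (size pre + size code) s') t c' ->
  exists2 t', exec (pre ++ code ++ post) (conf (size pre) s) (t' + t) c'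
    & t' <= T * ((block_factor K + 2) * bitlen V).
Proof.
elim=> {ls s T s'} [s|l ls s N T s' ok _ IH] pre post t c' code V1.
  by move=> _ -> _ _; rewrite addn0; exists 0.
move=> /andP[wl wls] ->.
set C := comp_loop (size pre) l; set D := comp_loops (size pre + size C) ls.
have -> : comp_loops (size pre) (l :: ls) = C ++ D by [].
rewrite all_cat size_cat => /andP[CV DV] szK ex.
have sz : size pre + size C = size (pre ++ C) by rewrite size_cat.
have [||||t1 ex1 t1B] := IH (pre ++ C) post t c' D V1 wls.
- by rewrite -sz.
- by [].
- by lia.
- by rewrite -sz -[(pre ++ C) ++ _]catA [C ++ D ++ post]catA -addnA.
have := @exec_loop pre l (D ++ post) V N s (t1 + t) c' wl V1 ok CV.
move: ex1 t1B; rewrite -sz -[(pre ++ C) ++ _]catA -[(C ++ D) ++ post]catA => ex1 t1B /(_ ex1) [t2 ex2 t2B].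
exists (t2 + t1); first by rewrite -addnA.
have /leq_block_factor CK : size C <= K by lia.
apply: leq_trans (leq_add t2B t1B) _; rewrite [leqRHS]mulnDl leq_add2r.
by rewrite leq_mul2l leq_mul2r leq_add2r CK !orbT.
Qed.

Lemma constants_bounded (code : program) : exists M, forall V, M <= V ->
  all (fun ins => all (leq^~ V) (constants ins)) code.
Proof.
elim: code => [|ins code [M IH]]; first by exists 0.
exists (maxn (\max_(k <- constants ins) k) M) => V.
rewrite geq_max => /andP[iV /IH] /= ->; rewrite andbT.
by apply/allP => k kI; apply: leq_trans iV; exact: (leq_bigmax_seq k kI isT).
Qed.

(** M and K depend on the program alone, not on the input or V; a polynomial time bound needs this
    uniformity. *)
Lemma computes_runs ls : all wf_loop ls ->
  exists M K, forall V input T s', 1 < V -> M <= V ->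
    runs V ls (State (fun _ _ => 0) input [::]) T s' ->
    exists2 t, computes (comp_loops 0 ls) input t (sout s')
      & t <= T * (K * bitlen V).
Proof.
move=> wls; set code := comp_loops 0 ls.
have [M MP] := constants_bounded code.
exists M, (block_factor (size code) + 2) => V input T s' V1 /MP kV r.
have [||t] := exec_runs r (pre := [::]) (post := [::]) (t := 0)
  (c' := conf (size code) s') (K := size code) V1 wls (erefl _) kV.
- by [].
- by apply: ExecHalt; rewrite cats0 /= onth_default.
rewrite cats0 /= addn0 => ex tB; exists t => //.
exists (conf (size code) s') => //.
rewrite /init_config (_ : Config _ _ _ _ = conf 0 (State (fun _ _ => 0) input [::])) //.
rewrite /conf /=; congr Config; apply: functional_extensionality => a.
by rewrite /flat; case: ifP.
Qed.

(** * The algorithm *)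

Section Sums.
Variable n : nat.

Lemma sum_pairs a (F : nat -> nat) :
  \sum_(u < a * n) F u = \sum_(i < a) \sum_(j < n) F (i * n + j).
Proof.
rewrite -(big_mkord xpredT F); elim: a => [|a IH]; first by rewrite big_geq ?big_ord0.
rewrite big_ord_recr /= -IH mulSnr (big_cat_nat _ (n := a * n)) ?leq_addr //=.
congr addn; rewrite -{1}[a * n]add0n big_addn addKn big_mkord.
by apply: eq_bigr => j _; rewrite addnC.
Qed.

Lemma divn_pair i j : j < n -> (i * n + j) %/ n = i.
Proof. by move=> jn; rewrite divnMDl ?divn_small ?addn0 //; lia. Qed.

Lemma modn_pair i j : j < n -> (i * n + j) %% n = j.
Proof. by move=> jn; rewrite modnMDl modn_small. Qed.

(** The indices with quotient y form one block of n consecutive numbers, which lies entirely below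
    t. *)
Lemma sum_div t y (F : nat -> nat) : 0 < n -> y.+1 * n <= t ->
  \sum_(u < t | u %/ n == y) F u = \sum_(v < n) F (y * n + v).
Proof.
move=> n0 yt; rewrite -(big_mkord (fun u => u %/ n == y) F).
have yn : y * n <= t by rewrite (leq_trans _ yt) // leq_mul2r leqnSn orbT.
rewrite (big_cat_nat _ (n := y.+1 * n)) //= (big_cat_nat _ (n := y * n)) //=; last first.
  by rewrite leq_mul2r leqnSn orbT.
rewrite big_nat_cond big_pred0 ?add0n => [|u]; last first.
  apply/negP => /andP[/andP[_ uy] /eqP yu].
  by have := leq_divM u n; rewrite yu; lia.
rewrite [X in _ + X]big_nat_cond [X in _ + X]big_pred0 ?addn0 => [|u]; last first.
  apply/negP => /andP[/andP[uy _] /eqP yu].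
  by have := ltn_ceil u n0; rewrite yu; lia.
rewrite -{1}[y * n]add0n big_addn mulSnr addKn -(big_mkord xpredT (fun v => F (y * n + v))).
rewrite big_nat_cond [RHS]big_nat_cond; apply: eq_big => v; last by rewrite addnC.
case: (v < n) / idP => vn; last by rewrite !andbF.
by rewrite addnC divn_pair // eqxx.
Qed.

Lemma sum_mod a x (F : nat -> nat) : x < n ->
  \sum_(u < a * n | u %% n == x) F u = \sum_(i < a) F (i * n + x).
Proof.
move=> xn; rewrite big_mkcond.
rewrite (sum_pairs a (fun u => if u %% n == x then F u else 0)).
apply: eq_bigr => i _; rewrite (bigD1 (Ordinal xn)) //= modn_pair // eqxx.
rewrite big1 ?addn0 // => j; rewrite modn_pair // -val_eqE /=.
by case: eqP.
Qed.

End Sums.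

(* Array 1 is the adjacency matrix, array 2 the sequence of its powers, arrays 3
   and 4 the in- and outdegrees, array 5 the numerators.  In array 0, the cells
   2, 3 and 4 hold n, (n^2)! and the denominator. *)

Definition eadd := Op Add.
Definition esub := Op Defs.Sub.
Definition emul := Op Mul.
Definition ediv := Op Div.
Definition emod x y := esub x (emul (ediv x y) y).

Definition vN := Get 0 (Cst 2).
Definition vF := Get 0 (Cst 3).
Definition vD := Get 0 (Cst 4).

Fixpoint quo (k : nat) : expr := if k is k'.+1 then ediv (quo k') vN else counter.
Definition digit (k : nat) : expr := emod (quo k) vN.

Definition increase (r : nat) (x v : expr) : cmd := Put r x (eadd (Get r x) v).

(** A loop with a single pass. The 1 is 0!, from which [read_loop] builds (n^2)!, one factor per
    matrix entry. *)
Definition init_loop : loop := (Cst 1, [:: In 0 (Cst 2); Put 0 (Cst 3) (Cst 1)]).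

(* With truncated subtraction, 1 - ((x - y) + (y - x)) is 1 if x = y and 0
   otherwise; the powers of the matrix start with the identity. *)
Definition read_loop : loop :=
  (emul vN vN,
   [:: In 1 counter;
       Put 2 counter (esub (Cst 1) (eadd (esub (quo 1) (digit 0))
                                         (esub (digit 0) (quo 1))));
       increase 3 (digit 0) (Get 1 counter);
       increase 4 (quo 1) (Get 1 counter);
       Put 0 (Cst 3) (emul vF (eadd counter (Cst 1)))]).

(* For the counter ((k * n + a) * n + b) * n + j, the entry (a, b) of the power
   k + 1 is increased by the entry (a, j) of the matrix times the entry (j, b)
   of its power k. *)
Definition walk_loop : loop :=
  (emul (emul vN vN) (emul vN vN),
   [:: increase 2 (eadd (quo 1) (emul vN vN))
         (emul (Get 1 (eadd (emul (digit 2) vN) (digit 0)))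
            (Get 2 (eadd (emul (eadd (emul (quo 3) vN) (digit 0)) vN) (digit 1))))]).

(* The counter is (((l * n + m) * n + a) * n + j) * n + i; the factors 1 - degree
   keep only the source a and the sinks j. *)
Definition term : expr :=
  emul (emul (esub (Cst 1) (Get 3 (digit 2))) (esub (Cst 1) (Get 4 (digit 1))))
    (emul (emul (Get 2 (eadd (emul (eadd (emul (quo 4) vN) (digit 2)) vN) (digit 0)))
       (Get 2 (eadd (emul (eadd (emul (eadd (digit 3) (Cst 1)) vN) (digit 0)) vN)
                  (digit 1))))
       (ediv vF (eadd (quo 4) (eadd (digit 3) (Cst 1))))).

Definition weight_loop : loop :=
  (emul (emul (emul vN vN) (emul vN vN)) vN,
   [:: increase 5 (digit 0) term; increase 0 (Cst 4) term]).

Definition output_loop : loop := (vN, [:: Out (Get 5 counter); Out vD]).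

Definition weight_program : seq loop :=
  [:: init_loop; read_loop; walk_loop; weight_loop; output_loop].

(** The loop control cells and n are kept apart, so that a loop invariant becomes a function from
    the counter to [data]. *)
Record data := Data {
  dF : nat; dD : nat;
  dE : nat -> nat; dW : nat -> nat; dI : nat -> nat; dO : nat -> nat;
  dM : nat -> nat;
  dinp : seq nat; dout : seq nat
}.

Definition store n c r (d : data) (a x : nat) : nat :=
  match a with
  | 0 => nth 0 [:: c; r; n; dF d; dD d] x
  | 1 => dE d x
  | 2 => dW d x
  | 3 => dI d x
  | 4 => dO d x
  | 5 => dM d x
  | _ => 0
  end.

Definition stt n c r (d : data) : state := State (store n c r d) (dinp d) (dout d).

Definition fset_at (f : nat -> nat) x v : nat -> nat :=
  fun y => if y == x then v else f y.

Section UpdateStore.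
Variables (n c r F D : nat) (E W I O M : nat -> nat) (i o : seq nat).
Notation st := (store n c r (Data F D E W I O M i o)).

Let ext2 (f g : nat -> nat -> nat) : (forall a x, f a x = g a x) -> f = g.
Proof. by move=> h; do 2!apply: functional_extensionality => ?. Qed.

Lemma upd_counter v : upd st 0 0 v = store n v r (Data F D E W I O M i o).
Proof. by apply: ext2 => -[|[|[|[|[|[|a]]]]]] [|x]. Qed.
Lemma upd_remaining v : upd st 0 1 v = store n c v (Data F D E W I O M i o).
Proof. by apply: ext2 => -[|[|[|[|[|[|a]]]]]] [|[|x]]. Qed.
Lemma upd_F v : upd st 0 3 v = store n c r (Data v D E W I O M i o).
Proof. by apply: ext2 => -[|[|[|[|[|[|a]]]]]] [|[|[|[|x]]]]. Qed.
Lemma upd_D v : upd st 0 4 v = store n c r (Data F v E W I O M i o).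
Proof. by apply: ext2 => -[|[|[|[|[|[|a]]]]]] [|[|[|[|[|x]]]]]. Qed.
Lemma upd_E x v : upd st 1 x v = store n c r (Data F D (fset_at E x v) W I O M i o).
Proof. by apply: ext2 => -[|[|[|[|[|[|a]]]]]]. Qed.
Lemma upd_W x v : upd st 2 x v = store n c r (Data F D E (fset_at W x v) I O M i o).
Proof. by apply: ext2 => -[|[|[|[|[|[|a]]]]]]. Qed.
Lemma upd_I x v : upd st 3 x v = store n c r (Data F D E W (fset_at I x v) O M i o).
Proof. by apply: ext2 => -[|[|[|[|[|[|a]]]]]]. Qed.
Lemma upd_O x v : upd st 4 x v = store n c r (Data F D E W I (fset_at O x v) M i o).
Proof. by apply: ext2 => -[|[|[|[|[|[|a]]]]]]. Qed.
Lemma upd_M x v : upd st 5 x v = store n c r (Data F D E W I O (fset_at M x v) i o).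
Proof. by apply: ext2 => -[|[|[|[|[|[|a]]]]]]. Qed.

Lemma state_stt j p : State st j p = stt n c r (Data F D E W I O M j p).
Proof. by congr State; apply: ext2 => -[|[|[|[|[|[|a]]]]]]. Qed.

End UpdateStore.

Definition updE :=
  (upd_counter, upd_remaining, upd_F, upd_D, upd_E, upd_W, upd_I, upd_O, upd_M).

Lemma eval_emod g x y : eval g (emod x y) = eval g x %% eval g y.
Proof. by rewrite /= {1}(divn_eq (eval g x) (eval g y)) addKn. Qed.

Lemma eval_eadd g x y : eval g (eadd x y) = eval g x + eval g y. Proof. by []. Qed.
Lemma eval_esub g x y : eval g (esub x y) = eval g x - eval g y. Proof. by []. Qed.
Lemma eval_emul g x y : eval g (emul x y) = eval g x * eval g y. Proof. by []. Qed.
Lemma eval_ediv g x y : eval g (ediv x y) = eval g x %/ eval g y. Proof. by []. Qed.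
Lemma eval_Get g r x : eval g (Get r x) = g r (eval g x). Proof. by []. Qed.
Lemma eval_Cst g k : eval g (Cst k) = k. Proof. by []. Qed.

Lemma eval_quoS g k : eval g (quo k.+1) = eval g (quo k) %/ eval g vN.
Proof. by []. Qed.
Lemma eval_quo0 g : eval g (quo 0) = g 0 0. Proof. by []. Qed.
Lemma eval_digit g k : eval g (digit k) = eval g (quo k) %% eval g vN.
Proof. exact: eval_emod. Qed.
Lemma eval_counter g : eval g counter = g 0 0. Proof. by []. Qed.
Lemma eval_vN g : eval g vN = g 0 2. Proof. by []. Qed.
Lemma eval_vF g : eval g vF = g 0 3. Proof. by []. Qed.
Lemma eval_vD g : eval g vD = g 0 4. Proof. by []. Qed.

Definition evalE := (eval_digit, eval_quoS, eval_quo0, eval_counter, eval_vN,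
  eval_vF, eval_vD, eval_emod, eval_eadd, eval_esub, eval_emul, eval_ediv,
  eval_Get, eval_Cst).

Lemma den_Put r x v s :
  den (Put r x v) s =
  State (upd (arr s) r (eval (arr s) x) (eval (arr s) v)) (sinp s) (sout s).
Proof. by []. Qed.

Lemma den_increase r x v s :
  den (increase r x v) s =
  State (upd (arr s) r (eval (arr s) x)
           (arr s r (eval (arr s) x) + eval (arr s) v)) (sinp s) (sout s).
Proof. by []. Qed.

Lemma dens_cons c cs s : dens (c :: cs) s = dens cs (den c s).
Proof. by []. Qed.

Lemma dens_reset n c r d : dens reset (stt n c r d) = stt n 0 r d.
Proof. by case: d => *; rewrite dens_cons den_Put /= updE. Qed.

Definition dbounded V (d : data) : Prop :=
  [/\ dF d <= V, dD d <= V, all (leq^~ V) (dinp d) &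
   [/\ forall x, dE d x <= V, forall x, dW d x <= V, forall x, dI d x <= V,
       forall x, dO d x <= V & forall x, dM d x <= V]].

Lemma sbounded_stt V n c r d : n <= V -> c <= V -> r <= V -> dbounded V d ->
  sbounded V (stt n c r d).
Proof.
move=> nV cV rV [FV DV iV [EV WV IV OV MV]]; split=> //.
case=> [|[|[|[|[|[|a]]]]]] x _ //=; by move: x => [|[|[|[|[|x]]]]] //=; rewrite nth_nil.
Qed.

Lemma loop_stt n V N l (d : nat -> data) c0 :
  0 < N -> N <= V -> n <= V -> c0 <= V ->
  (forall t, t <= N -> dbounded V (d t)) ->
  (forall c r d, eval (store n c r d) l.1 = N) ->
  (forall t r, t < N -> dens l.2 (stt n t r (d t)) = stt n t r (d t.+1)) ->
  loop_ok V l N (stt n c0 0 (d 0)) /\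
  run_loop l N (stt n c0 0 (d 0)) = stt n N 0 (d N).
Proof.
move=> N0 NV nV c0V dV lN ld.
(* Before the first iteration cell 1 still holds the initial 0. *)
pose rem t := if t is 0 then 0 else N - t.
have runE t : t <= N -> run_loop l t (stt n c0 0 (d 0)) = stt n t (rem t) (d t).
  elim: t => [|t IH] tN; first exact: dens_reset.
  rewrite /run_loop iterS -/(run_loop l t _) IH ?(ltnW tN) // /iteration dens_cat.
  rewrite ld //; case: (d t.+1) => *.
  rewrite !dens_cons !den_Put !evalE /= updE lN updE.
  by rewrite addn1.
split; last by rewrite runE //; congr stt; rewrite /rem; case: (N) => // m; rewrite subnn.
split=> //.
- by apply: sbounded_stt => //; apply: dV.
- move=> t tN; rewrite runE ?(ltnW tN) //; apply: sbounded_stt => //.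
  + exact: leq_trans (ltnW tN) NV.
  + by rewrite /rem; case: (t) => // m; apply: leq_trans (leq_subr _ _) NV.
  + exact/dV/ltnW.
- by move=> t tN; rewrite runE //= subn_gt0.
Qed.

Lemma den_In r x s :
  den (In r x) s =
  State (upd (arr s) r (eval (arr s) x) (head 0 (sinp s))) (behead (sinp s)) (sout s).
Proof. by []. Qed.

Lemma den_Out v s :
  den (Out v) s = State (arr s) (sinp s) (rcons (sout s) (eval (arr s) v)).
Proof. by []. Qed.

Section StoreE.
Variables (n c r F D : nat) (E W I O M : nat -> nat) (i o : seq nat).
Notation d := (Data F D E W I O M i o).
Lemma arr_stt : arr (stt n c r d) = store n c r d. Proof. by []. Qed.
Lemma sinp_stt : sinp (stt n c r d) = i. Proof. by []. Qed.
Lemma sout_stt : sout (stt n c r d) = o. Proof. by []. Qed.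
Lemma store_counter : store n c r d 0 0 = c. Proof. by []. Qed.
Lemma store_n : store n c r d 0 2 = n. Proof. by []. Qed.
Lemma store_F : store n c r d 0 3 = F. Proof. by []. Qed.
Lemma store_D : store n c r d 0 4 = D. Proof. by []. Qed.
Lemma store_E x : store n c r d 1 x = E x. Proof. by []. Qed.
Lemma store_W x : store n c r d 2 x = W x. Proof. by []. Qed.
Lemma store_I x : store n c r d 3 x = I x. Proof. by []. Qed.
Lemma store_O x : store n c r d 4 x = O x. Proof. by []. Qed.
Lemma store_M x : store n c r d 5 x = M x. Proof. by []. Qed.
End StoreE.

Definition storeE := (arr_stt, sinp_stt, sout_stt, store_counter, store_n,
  store_F, store_D, store_E, store_W, store_I, store_O, store_M).

Lemma fset_at_same f x v : fset_at f x v x = v.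
Proof. by rewrite /fset_at eqxx. Qed.

(** * Loop invariants *)

Section Correct.
Variables (n : nat) (enc : seq nat).

Fixpoint walk_count (k a b : nat) : nat :=
  if k is k'.+1 then \sum_(j < n) nth 0 enc (a * n + j) * walk_count k' j b
  else a == b.

Definition walk_summand (u : nat) : nat :=
  nth 0 enc ((u %/ n %/ n) %% n * n + u %% n) *
  walk_count (u %/ n %/ n %/ n) (u %% n) (u %/ n %% n).

Definition column_sum (t x : nat) := \sum_(u < t | u %% n == x) nth 0 enc u.
Definition row_sum (t x : nat) := \sum_(u < t | u %/ n == x) nth 0 enc u.

Definition entries (t x : nat) := if x < t then nth 0 enc x else 0.
Definition identity (t x : nat) : nat := (x < t) && (x %/ n == x %% n).
(** The summands use the final walk counts rather than the current table; this is legitimate since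
    every entry is complete when it is read. *)
Definition walk_table (t x : nat) :=
  identity (n * n) x + \sum_(u < t | u %/ n + n * n == x) walk_summand u.

Let F := (n * n)`!.
Let I := column_sum (n * n).
Let O := row_sum (n * n).

Definition weight_summand (u : nat) : nat :=
  let i := u %% n in let j := u %/ n %% n in let a := u %/ n %/ n %% n in
  let m := u %/ n %/ n %/ n %% n in let l := u %/ n %/ n %/ n %/ n in
  (1 - I a) * (1 - O j) *
  (walk_count l a i * walk_count (m + 1) i j * (F %/ (l + (m + 1)))).

Definition numerators (t x : nat) := \sum_(u < t | u %% n == x) weight_summand u.
Definition denominator (t : nat) := \sum_(u < t) weight_summand u.

Definition fractions (t : nat) : seq nat :=
  flatten [seq [:: numerators (n * n * (n * n) * n) x;
                   denominator (n * n * (n * n) * n)] | x <- iota 0 t].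

Definition data_read t : data :=
  Data t`! 0 (entries t) (identity t) (column_sum t) (row_sum t) (fun=> 0)
       (drop t enc) [::].

Definition data_walk t : data :=
  Data F 0 (entries (n * n)) (walk_table t) I O (fun=> 0) [::] [::].

Definition data_weight t : data :=
  Data F (denominator t) (entries (n * n)) (walk_table (n * n * (n * n))) I O
       (numerators t) [::] [::].

Definition data_output t : data :=
  Data F (denominator (n * n * (n * n) * n)) (entries (n * n))
       (walk_table (n * n * (n * n))) I O
       (numerators (n * n * (n * n) * n)) [::] (fractions t).

(** The common step of all accumulating tables: iteration t adds [val t] to the cell [idx t] and
    touches no other. *)
Lemma fset_at_sum (t : nat) (idx val : nat -> nat) (f : nat -> nat) :
  let S t x := f x + \sum_(u < t | idx u == x) val u in
  fset_at (S t) (idx t) (S t (idx t) + val t) = S t.+1.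
Proof.
move=> S; apply: functional_extensionality => x.
rewrite /fset_at /S big_mkcond [in RHS]big_mkcond /= big_ord_recr /= -!big_mkcond /=.
case: eqP => [->|/eqP/negPf]; first by rewrite eqxx addnA.
by rewrite eq_sym => ->; rewrite addn0.
Qed.

Lemma fset_at_sum0 (t : nat) (idx val : nat -> nat) :
  let S t x := \sum_(u < t | idx u == x) val u in
  fset_at (S t) (idx t) (S t (idx t) + val t) = S t.+1.
Proof.
move=> S; apply: functional_extensionality => x.
have := congr1 (fun f => f x) (fset_at_sum t idx val (fun=> 0)).
by rewrite /fset_at /= !add0n.
Qed.

Lemma behead_drop_enc t : behead (drop t enc) = drop t.+1 enc.
Proof. by rewrite -drop1 drop_drop add1n. Qed.

Lemma head_drop_enc t : head 0 (drop t enc) = nth 0 enc t.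
Proof. by rewrite -nth0 nth_drop addn0. Qed.

Lemma entriesS t : fset_at (entries t) t (nth 0 enc t) = entries t.+1.
Proof.
apply: functional_extensionality => x; rewrite /fset_at /entries.
by case: eqP => [->|xt]; rewrite ?leqnn // ltnS [x <= t]leq_eqVlt (negPf (introN eqP xt)).
Qed.

Lemma identityS t :
  fset_at (identity t) t (1 - (t %/ n - t %% n + (t %% n - t %/ n))) = identity t.+1.
Proof.
apply: functional_extensionality => x; rewrite /fset_at /identity.
case: eqP => [->|xt]; last by rewrite ltnS [x <= t]leq_eqVlt (negPf (introN eqP xt)).
by rewrite leqnn; lia.
Qed.

Lemma dens_read t r :
  dens read_loop.2 (stt n t r (data_read t)) = stt n t r (data_read t.+1).
Proof.
rewrite /data_read !dens_cons.
rewrite (den_In _ _ (stt _ _ _ _)) !(evalE, storeE) updE state_stt.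
rewrite (den_Put _ _ _ (stt _ _ _ _)) !(evalE, storeE) updE state_stt.
rewrite (den_increase _ _ _ (stt _ _ _ _)) !(evalE, storeE) updE state_stt.
rewrite (den_increase _ _ _ (stt _ _ _ _)) !(evalE, storeE) updE state_stt.
rewrite (den_Put _ _ _ (stt _ _ _ _)) !(evalE, storeE) updE state_stt.
rewrite !fset_at_same head_drop_enc behead_drop_enc entriesS identityS.
rewrite (fset_at_sum0 t (modn^~ n) (nth 0 enc)) (fset_at_sum0 t (divn^~ n) (nth 0 enc)).
by rewrite addn1 factS mulnC.
Qed.

Lemma dens_output t r :
  dens output_loop.2 (stt n t r (data_output t)) = stt n t r (data_output t.+1).
Proof.
rewrite /data_output !dens_cons.
rewrite (den_Out _ (stt _ _ _ _)) !(evalE, storeE) state_stt.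
rewrite (den_Out _ (stt _ _ _ _)) !(evalE, storeE) state_stt.
congr (stt _ _ _ (Data _ _ _ _ _ _ _ _ _)).
rewrite /fractions -[in RHS]addn1 iotaD map_cat flatten_cat /= add0n.
by rewrite -!cats1 -catA.
Qed.

Lemma data_read0 : data_read 0 = Data 1 0 (fun=> 0) (fun=> 0) (fun=> 0) (fun=> 0) (fun=> 0) enc [::].
Proof.
rewrite /data_read drop0; congr Data; apply: functional_extensionality => x.
- exact: big_ord0.
- exact: big_ord0.
Qed.

Lemma data_walk_weight : data_walk (n * n * (n * n)) = data_weight 0.
Proof.
rewrite /data_walk /data_weight; congr Data; first by rewrite /denominator big_ord0.
by apply: functional_extensionality => x; rewrite /numerators big_ord0.
Qed.

Lemma data_weight_output : data_weight (n * n * (n * n) * n) = data_output 0.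
Proof. by []. Qed.

Hypothesis n0 : 0 < n.

(** For k > 0, the updates of the k-th power come from the counters between (k - 1) n^3 and k
    n^3. *)
Lemma walk_table_done t k j b : j < n -> b < n -> k * (n * n * n) <= t ->
  walk_table t ((k * n + j) * n + b) = walk_count k j b.
Proof.
move=> jn bn kt; rewrite /walk_table /identity divn_pair // modn_pair //.
case: k kt => [|k] kt.
  (* Updates are shifted by n^2 and never reach the identity matrix stored first. *)
  rewrite mul0n add0n big1 ?addn0 => [|u /eqP ux]; last by nia.
  by rewrite (_ : j * n + b < n * n) //; nia.
rewrite (_ : _ < n * n = false) ?add0n; last by nia.
rewrite (eq_bigl (fun u : 'I_t => u %/ n == (k * n + j) * n + b)); last first.
  by move=> u; apply/eqP/eqP; nia.
rewrite sum_div //; last by nia.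
apply: eq_bigr => v _; rewrite /walk_summand.
by rewrite !(divn_pair _ (ltn_ord v)) !(modn_pair _ (ltn_ord v)) !divn_pair ?modn_pair.
Qed.

(** After n^4 iterations the powers 0 to n are complete, which covers both l and m + 1. *)
Lemma term_value t (i o : seq nat) c M r : t < n * n * (n * n) * n ->
  eval (store n t r (Data F c (entries (n * n)) (walk_table (n * n * (n * n)))
         I O M i o)) term = weight_summand t.
Proof.
move=> tn; rewrite /term !(evalE, storeE).
have l_lt : t %/ n %/ n %/ n %/ n <= n.
  by rewrite -!divnMA ltnW // ltn_divLR ?muln_gt0 ?n0 //; nia.
rewrite !walk_table_done ?ltn_mod //.
- have := ltn_pmod (t %/ n %/ n %/ n) n0; set m := _ %% n; nia.
- nia.
Qed.

Lemma dens_weight t r : t < n * n * (n * n) * n ->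
  dens weight_loop.2 (stt n t r (data_weight t)) = stt n t r (data_weight t.+1).
Proof.
move=> tn; rewrite /data_weight !dens_cons.
rewrite (den_increase _ _ _ (stt _ _ _ _)) arr_stt (term_value _ _ _ _ _ tn) !(evalE, storeE) updE state_stt.
rewrite (den_increase _ _ _ (stt _ _ _ _)) arr_stt (term_value _ _ _ _ _ tn) !(evalE, storeE) updE state_stt.
rewrite (fset_at_sum0 t (modn^~ n) weight_summand).
by rewrite /denominator big_ord_recr.
Qed.

Hypothesis size_enc : size enc = n * n.

Lemma entries_enc x : entries (n * n) x = nth 0 enc x.
Proof. by rewrite /entries; case: ltnP => // xn; rewrite nth_default ?size_enc. Qed.

Lemma dens_walk t r :
  dens walk_loop.2 (stt n t r (data_walk t)) = stt n t r (data_walk t.+1).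
Proof.
rewrite /data_walk dens_cons (den_increase _ _ _ (stt _ _ _ _)) !(evalE, storeE) updE state_stt.
rewrite entries_enc walk_table_done ?ltn_mod //; last first.
  (* The power being read has index t / n^3, and n^3 times this index is at most t. *)
  by rewrite -!divnMA -[n * n * n]mulnA leq_divM.
by rewrite (fset_at_sum t (fun u => u %/ n + n * n) walk_summand).
Qed.

Lemma data_read_walk : data_read (n * n) = data_walk 0.
Proof.
rewrite /data_read /data_walk drop_oversize ?size_enc //; congr Data.
apply: functional_extensionality => x.
by rewrite /walk_table big_ord0 addn0.
Qed.

End Correct.

Lemma nth_flatten_uniform (T : Type) (x0 : T) (n : nat) (ss : seq (seq T)) (i j : nat) :
  all (fun s => size s == n) ss -> j < n ->
  nth x0 (flatten ss) (i * n + j) = nth x0 (nth [::] ss i) j.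
Proof.
move=> + jn; elim: ss i => [|s ss IH] i /=; first by rewrite !nth_nil.
case/andP => /eqP sn ssn; rewrite nth_cat sn.
case: i => [|i]; first by rewrite jn.
rewrite ifF; last by rewrite mulSn; lia.
by rewrite /= -IH //; congr nth; rewrite mulSn; lia.
Qed.

Lemma leq_sum_const t (P : pred 'I_t) (f : 'I_t -> nat) M :
  (forall u, P u -> f u <= M) -> \sum_(u < t | P u) f u <= t * M.
Proof.
move=> fM; apply: (@leq_trans (\sum_(u < t | P u) M)); first exact: leq_sum.
rewrite sum_nat_const leq_mul2r; apply/orP; right.
by rewrite -[leqRHS]card_ord max_card.
Qed.

Lemma fact_le_exp m t : t <= m -> t`! <= m ^ t.
Proof.
elim: t => // t IH tm; rewrite factS expnS leq_mul // IH //; exact: ltnW.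
Qed.

(** * Size of the numbers and number of iterations *)

Section Bounds.
Variables (n : nat) (enc : seq nat).
Hypotheses (n3 : 3 <= n) (size_enc : size enc = n * n) (enc_le1 : all (leq^~ 1) enc).

Let n0 : 0 < n. Proof. exact: leq_trans n3. Qed.

(** The largest values are sums of at most n^5 terms, each at most n^(2n^2) for the factorial times
    n^(2n) for two walk counts; for n >= 3 the exponent 2n^2 + 2n + 5 is at most 4n^2. *)
Definition value_bound := n ^ (4 * (n * n)).

Lemma leq_value_bound a : a <= 4 * (n * n) -> n ^ a <= value_bound.
Proof. by move=> h; rewrite /value_bound leq_pexp2l. Qed.

Lemma nth_enc_le1 x : nth 0 enc x <= 1.
Proof.
case: (ltnP x (size enc)) => xs; last by rewrite nth_default.
exact: (allP enc_le1 _ (mem_nth 0 xs)).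
Qed.

Lemma walk_count_le k a b : walk_count n enc k a b <= n ^ k.
Proof.
elim: k a => [|k IH] a /=; first by case: eqP.
rewrite expnS; apply: leq_sum_const => j _.
by rewrite -[leqRHS]mul1n leq_mul ?nth_enc_le1.
Qed.

Lemma fact_bound t : t <= n * n -> t`! <= n ^ (2 * (n * n)).
Proof.
move=> tn; apply: leq_trans (leq_trans (fact_le_exp tn) _) (leqnn _).
by rewrite mulnn -expnM leq_pexp2l // leq_mul2l -mulnn tn.
Qed.

Lemma walk_table_le t x : t <= n * n * (n * n) -> walk_table n enc t x <= value_bound.
Proof.
(* One for the identity, and at most n^4 updates by walk counts of length at most n. *)
move=> tn; apply: (@leq_trans (1 + n ^ 4 * n ^ n)).
  rewrite leq_add //; first by rewrite /identity; case: (_ && _).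
  apply: (@leq_trans (t * n ^ n)); last first.
    by rewrite leq_mul2r (leq_trans tn) ?orbT // !expnS expn0 muln1 !mulnA.
  apply: (leq_sum_const (f := fun u => walk_summand n enc u)) => u _.
  rewrite /walk_summand -[leqRHS]mul1n leq_mul ?nth_enc_le1 //.
  apply: leq_trans (walk_count_le _ _ _) _; rewrite leq_pexp2l //.
  have := ltn_ord u; move: tn; rewrite -!divnMA => tn ut.
  apply: ltnW; rewrite ltn_divLR ?muln_gt0 ?n0 //.
  by apply: leq_trans ut (leq_trans tn _); rewrite !mulnA.
rewrite -expnD; apply: leq_trans (leq_value_bound (a := (4 + n).+1) _); last by nia.
have := expn_gt0 n (4 + n); rewrite n0 /= expnS => h; nia.
Qed.

Lemma weight_summand_le u : u < n * n * (n * n) * n ->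
  weight_summand n enc u <= n ^ (2 * (n * n) + 2 * n).
Proof.
move=> un; rewrite /weight_summand /=.
rewrite -[leqRHS]mul1n leq_mul //.
  by rewrite -[leqRHS]mul1n leq_mul // leq_subr.
rewrite [2 * (n * n) + _]addnC expnD leq_mul //; last first.
  by apply: leq_trans (leq_div _ _) _; apply: fact_bound.
rewrite mul2n -addnn expnD leq_mul //.
  apply: leq_trans (walk_count_le _ _ _) _; rewrite leq_pexp2l //.
  rewrite -!divnMA; apply: ltnW; rewrite ltn_divLR ?muln_gt0 ?n0 //.
  by apply: leq_trans un _; rewrite !mulnA.
apply: leq_trans (walk_count_le _ _ _) _; rewrite leq_pexp2l //.
by rewrite addn1 ltn_mod.
Qed.

Lemma sum_weight_summand_le t (P : pred nat) : t <= n * n * (n * n) * n ->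
  \sum_(u < t | P u) weight_summand n enc u <= value_bound.
Proof.
move=> tn; apply: (@leq_trans (t * n ^ (2 * (n * n) + 2 * n))).
  apply: (leq_sum_const (f := fun u : 'I_t => weight_summand n enc u)) => u _.
  by apply: weight_summand_le; apply: leq_trans tn.
apply: (@leq_trans (n ^ 5 * n ^ (2 * (n * n) + 2 * n))).
  by rewrite leq_mul2r (leq_trans tn) ?orbT // !expnS expn0 muln1 !mulnA.
by rewrite -expnD; apply: leq_value_bound; nia.
Qed.

Lemma counts_le t (P : pred nat) : t <= n * n ->
  \sum_(u < t | P u) nth 0 enc u <= value_bound.
Proof.
move=> tn; apply: (@leq_trans (t * 1)).
  by apply: (leq_sum_const (f := fun u : 'I_t => nth 0 enc u)) => u _; apply: nth_enc_le1.
by rewrite muln1 (leq_trans tn) // mulnn; apply: leq_value_bound; nia.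
Qed.

Lemma value_bound_gt0 : 0 < value_bound. Proof. by rewrite expn_gt0 n0. Qed.

Lemma fact_value_bound t : t <= n * n -> t`! <= value_bound.
Proof. by move=> /fact_bound /leq_trans; apply; apply: leq_value_bound; nia. Qed.

Lemma entries_le t x : entries enc t x <= value_bound.
Proof.
apply: leq_trans value_bound_gt0; rewrite /entries; case: ifP => // _.
exact: nth_enc_le1.
Qed.

Lemma data_read_le t : t <= n * n -> dbounded value_bound (data_read n enc t).
Proof.
move=> tn; split; rewrite //=.
- exact: fact_value_bound.
- apply/allP => x /mem_drop /(allP enc_le1) x1.
  exact: leq_trans x1 value_bound_gt0.
- split=> // x; first exact: entries_le.
  + by apply: leq_trans value_bound_gt0; rewrite /identity; case: (_ && _).
  + exact: (counts_le (fun u => u %% n == x)).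
  + exact: (counts_le (fun u => u %/ n == x)).
Qed.

Lemma data_walk_le t : t <= n * n * (n * n) -> dbounded value_bound (data_walk n enc t).
Proof.
move=> tn; split; rewrite //=; first exact: fact_value_bound.
split=> // x; first exact: entries_le.
- exact: walk_table_le.
- exact: (counts_le (fun u => u %% n == x)).
- exact: (counts_le (fun u => u %/ n == x)).
Qed.

Lemma data_weight_le t : t <= n * n * (n * n) * n ->
  dbounded value_bound (data_weight n enc t).
Proof.
move=> tn; split; rewrite //=; first exact: fact_value_bound.
  exact: (sum_weight_summand_le xpredT).
split=> // x; first exact: entries_le.
- exact: walk_table_le.
- exact: (counts_le (fun u => u %% n == x)).
- exact: (counts_le (fun u => u %/ n == x)).
- exact: (sum_weight_summand_le (fun u => u %% n == x)).
Qed.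

Lemma data_output_le t : dbounded value_bound (data_output n enc t).
Proof. exact: (data_weight_le (leqnn _)). Qed.

Lemma dbounded_leq V V' d : V <= V' -> dbounded V d -> dbounded V' d.
Proof.
move=> VV [h1 h2 h3 [h4 h5 h6 h7 h8]]; split; try exact: leq_trans VV.
  by apply: sub_all h3 => x /leq_trans; apply.
by split=> x; apply: leq_trans VV.
Qed.

Definition run_time := 2 + ((n * n).+1 + ((n * n * (n * n)).+1 +
  ((n * n * (n * n) * n).+1 + (n.+1 + 0)))).

Lemma runs_weight_program V : value_bound <= V ->
  runs V weight_program (State (fun _ _ => 0) (n :: enc) [::]) run_time
    (stt n n 0 (data_output n enc n)).
Proof.
move=> BV.
have le_n a : a <= 5 -> n ^ a <= V.
  by move=> a5; apply: leq_trans BV; apply: leq_value_bound; nia.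
have [V1 Vn V2 V4 V5] : [/\ 1 <= V, n <= V, n * n <= V, n * n * (n * n) <= V
    & n * n * (n * n) * n <= V].
  have := (le_n 0 isT, le_n 1 isT, le_n 2 isT, le_n 4 isT, le_n 5 isT).
  by rewrite !expnS !expn0 !muln1 !mulnA => -[[[[]]]].
have dV d : dbounded value_bound d -> dbounded V d by apply: dbounded_leq.
set s0 := State _ _ _.
have e0 : dens reset s0 = s0.
  by congr State; do 2!apply: functional_extensionality => ?; rewrite /upd; case: ifP.
(* As n is not yet in memory, [loop_stt] does not apply and this pass is computed directly. *)
have e1 : run_loop init_loop 1 s0 = stt n 1 0 (data_read n enc 0).
  have -> : run_loop init_loop 1 s0 = dens (iteration init_loop) (dens reset s0) by [].
  rewrite e0 data_read0 /stt /=; congr State.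
  apply: functional_extensionality => a; apply: functional_extensionality => x.
  by move: a x => [|[|[|[|[|[|a]]]]]] [|[|[|[|[|x]]]]]; rewrite /upd //= nth_nil.
have sV : sbounded V s0.
  split=> //=; rewrite Vn /=; apply: sub_all enc_le1 => x x1.
  exact: leq_trans x1 V1.
apply: (@RunsCons V init_loop _ s0 1).
  split=> // t; rewrite ltnS leqn0 => /eqP->; first by rewrite [run_loop _ _ _]e0.
  by rewrite e1.
rewrite e1.
have [ok e2] := @loop_stt n V (n * n) read_loop (data_read n enc) 1
  ltac:(by rewrite muln_gt0 n0) V2 Vn V1 (fun t tn => dV _ (data_read_le tn))
  (fun _ _ _ => erefl) (fun t r _ => dens_read n enc t r).
apply: RunsCons ok _; rewrite e2 data_read_walk //.
have [ok' e3] := @loop_stt n V (n * n * (n * n)) walk_loop (data_walk n enc) (n * n)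
  ltac:(by rewrite !muln_gt0 n0) V4 Vn V2 (fun t tn => dV _ (data_walk_le tn))
  (fun _ _ _ => erefl) (fun t r _ => dens_walk n0 size_enc t r).
apply: RunsCons ok' _; rewrite e3 data_walk_weight.
have [ok'' e4] := @loop_stt n V (n * n * (n * n) * n) weight_loop (data_weight n enc)
  (n * n * (n * n)) ltac:(by rewrite !muln_gt0 n0) V5 Vn V4
  (fun t tn => dV _ (data_weight_le tn)) (fun _ _ _ => erefl)
  (fun t r tn => dens_weight enc n0 r tn).
apply: RunsCons ok'' _; rewrite e4 data_weight_output.
have [ok5 e5] := @loop_stt n V n output_loop (data_output n enc)
  (n * n * (n * n) * n) n0 Vn Vn V5
  (fun t tn => dV _ (data_output_le t)) (fun _ _ _ => erefl)
  (fun t r _ => dens_output n enc t r).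
by apply: RunsCons ok5 _; rewrite e5; apply: RunsNil.
Qed.

End Bounds.

(** * The computed fractions are the weights *)

Definition adjacency (n : nat) (e : rel 'I_n) : seq nat :=
  [seq nat_of_bool (e i j) | i <- enum 'I_n, j <- enum 'I_n].

Section Adjacency.
Variables (n : nat) (e : rel 'I_n).

Lemma size_adjacency : size (adjacency e) = n * n.
Proof. by rewrite size_allpairs size_enum_ord. Qed.

Lemma adjacency_le1 : all (leq^~ 1) (adjacency e).
Proof. by apply/allP => x /allpairsP[[i j] [_ _ ->]]; case: (e _ _). Qed.

Lemma nth_adjacency (i j : 'I_n) : nth 0 (adjacency e) (i * n + j) = e i j.
Proof.
rewrite /adjacency nth_flatten_uniform ?ltn_ord //; last first.
  by apply/allP => s /mapP[k _ ->]; rewrite size_map size_enum_ord.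
by rewrite (nth_map i) ?size_enum_ord // (nth_map j) ?size_enum_ord // !nth_ord_enum.
Qed.

Lemma walk_count_walks k (a b : 'I_n) : walk_count n (adjacency e) k a b = walks e k a b.
Proof.
elim: k a => [|k IH] a //=; rewrite [RHS]big_mkcond; apply: eq_bigr => j _.
by rewrite nth_adjacency IH; case: (e a j); rewrite ?mul1n.
Qed.

End Adjacency.

Section NetworkWeights.
Variables (n : nat) (e : rel 'I_n) (s : 'I_n).
Hypothesis net : network e s.

Let n3 : 3 <= n. Proof. by have := network_card net; rewrite card_ord. Qed.
Let n0 : 0 < n. Proof. exact: leq_trans n3. Qed.

Local Notation enc := (adjacency e).

(** Truncated subtraction turns an indegree into the indicator of indegree 0, which characterizes
    the source. *)
Lemma column_sum_source (a : 'I_n) : 1 - column_sum n enc (n * n) a = (a == s).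
Proof.
rewrite /column_sum sum_mod // (eq_bigr (fun i : 'I_n => nat_of_bool (e i a))); last first.
  by move=> i _; rewrite nth_adjacency.
case: eqP => [->|/eqP a_s].
  rewrite big1 // => i _.
  by have := (network_source net s).2 erefl i => /negPf->.
have [i eia] : exists i, e i a.
  apply/existsP; apply: contraNT a_s; rewrite negb_exists => /forallP noin.
  by apply/eqP/(network_source net a).1.
by rewrite (bigD1 i) //= eia.
Qed.

Lemma row_sum_sink (a : 'I_n) : 1 - row_sum n enc (n * n) a = (a \notin nonsinks e).
Proof.
rewrite /row_sum sum_div //; last by rewrite leq_mul2r ltn_ord orbT.
rewrite (eq_bigr (fun j : 'I_n => nat_of_bool (e a j))); last first.
  by move=> j _; rewrite nth_adjacency.
rewrite inE; case: (boolP (_ != set0)) => [/set0Pn[j]|].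
  by rewrite inE => eaj; rewrite (bigD1 j) //= eaj.
rewrite negbK => /eqP/setP e0; rewrite big1 // => j _.
by have := e0 j; rewrite !inE => ->.
Qed.

(** Reading the counter in base n restores the nested sums; the degree factors leave only a = s and
    the sinks j. *)
Lemma numerators_walks (i : 'I_n) :
  numerators n enc (n * n * (n * n) * n) i =
  \sum_(l < n) \sum_(m < n) walks e l s i * exits e m.+1 i *
     ((n * n)`! %/ (l + m.+1)).
Proof.
transitivity (\sum_(l < n) \sum_(m < n) \sum_(a < n) \sum_(j < n)
    weight_summand n enc ((((l * n + m) * n + a) * n + j) * n + i)).
  rewrite /numerators sum_mod // (_ : n * n * (n * n) = n * n * n * n) ?mulnA //.
  rewrite (sum_pairs n (n * n * n) (fun w => weight_summand n enc (w * n + i))).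
  rewrite (sum_pairs n (n * n)
    (fun w => \sum_(j < n) weight_summand n enc ((w * n + j) * n + i))).
  by rewrite (sum_pairs n n (fun w => \sum_(a < n) \sum_(j < n)
    weight_summand n enc (((w * n + a) * n + j) * n + i))).
apply: eq_bigr => l _; apply: eq_bigr => m _.
have summand (a j : 'I_n) :
    weight_summand n enc ((((l * n + m) * n + a) * n + j) * n + i) =
    (a == s) * (j \notin nonsinks e) *
    (walks e l a i * walks e m.+1 i j * ((n * n)`! %/ (l + m.+1))).
  rewrite /weight_summand /= !(divn_pair _ (ltn_ord _)) !(modn_pair _ (ltn_ord _)).
  by rewrite column_sum_source row_sum_sink addn1 !walk_count_walks.
rewrite (bigD1 s) //= [X in _ + X]big1 ?addn0 => [|a /negPf a_s]; last first.
  by rewrite big1 // => j _; rewrite summand a_s.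
rewrite /exits big_distrr big_distrl [RHS]big_mkcond /=; apply: eq_bigr => j _.
by rewrite summand eqxx mul1n; case: ifP; rewrite ?mul1n.
Qed.

Lemma numerators_weight (i : 'I_n) :
  ((numerators n enc (n * n * (n * n) * n) i)%:R =
   weight e s i * ((n * n)`!%:R * #|paths e s|%:R) :> rat)%R.
Proof.
have := card_paths_gt0 net; rewrite numerators_walks weight_walks; last exact: network_acyclic net.
move: #|paths e s| => N N0; rewrite card_ord natr_sum mulr_suml.
apply: eq_bigr => l _; rewrite natr_sum mulr_suml; apply: eq_bigr => m _.
(* Since l + m + 1 <= 2n - 1 <= n^2, the integer division in the program is exact. *)
have d : (l + m.+1 %| (n * n)`!)%N.
  apply: dvdn_fact; rewrite addnS /=.
  have := ltn_ord l; have := ltn_ord m; move: n3; nia.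
have P0 : (N%:R != 0 :> rat)%R by rewrite pnatr_eq0 -lt0n.
have d0 : ((l + m.+1)%N%:R != 0 :> rat)%R by rewrite pnatr_eq0 addnS.
rewrite natrM -{2}(divnK d) natrM; field.
by rewrite P0 nat1r -natrD.
Qed.

(** The denominator is the sum of all numerators, and the weights sum to 1. *)
Lemma denominator_weight :
  ((denominator n enc (n * n * (n * n) * n))%:R =
   (n * n)`!%:R * #|paths e s|%:R :> rat)%R.
Proof.
have -> : denominator n enc (n * n * (n * n) * n) =
    \sum_(i < n) numerators n enc (n * n * (n * n) * n) i.
  rewrite /denominator (sum_pairs n _ (weight_summand n enc)) exchange_big /=.
  by apply: eq_bigr => i _; rewrite /numerators sum_mod.
rewrite natr_sum (eq_bigr _ (fun i _ => numerators_weight i)) -mulr_suml.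
by rewrite sum_weight // mul1r.
Qed.

Lemma fractions_represent : represents (fractions n enc n) (weight e s).
Proof.
have P0 : ((n * n)`!%:R * #|paths e s|%:R != 0 :> rat)%R.
  rewrite mulf_neq0 // pnatr_eq0 -lt0n ?fact_gt0 //.
  exact: card_paths_gt0.
have nthE (i : 'I_n) b : b < 2 -> nth 0 (fractions n enc n) (i * 2 + b) =
    nth 0 [:: numerators n enc (n * n * (n * n) * n) i;
              denominator n enc (n * n * (n * n) * n)] b.
  move=> b2; rewrite /fractions nth_flatten_uniform //; last first.
    by apply/allP => q /mapP[k _ ->].
  by rewrite (nth_map 0) ?size_iota // nth_iota.
split=> [|i].
  rewrite size_flatten /shape -map_comp sumnE big_map big_const_seq count_predT.
  by rewrite size_iota iter_addn_0 mul2n.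
have -> : i.*2.+1 = i * 2 + 1 by rewrite addn1 muln2.
have -> : i.*2 = i * 2 + 0 by rewrite addn0 muln2.
rewrite !nthE //= numerators_weight denominator_weight mulfK //; split=> //.
by rewrite -(pnatr_eq0 rat) denominator_weight.
Qed.

End NetworkWeights.

Theorem mainTheorem3 :
  (exists (prog : program) (p : {poly nat}),
     forall (n : nat) (e : rel 'I_n) (s : 'I_n), network e s ->
       exists (output : seq nat) (t : nat),
         [/\ computes prog (encode_graph e) t output,
             represents output (weight e s)
           & t <= p.[n]%R])
  /\
  (exists a : rat, (1 < a)%R /\
     forall m : nat, exists (n : nat) (e : rel 'I_n) (s : 'I_n),
       [/\ m <= n, network e s & (a ^+ n <= #|paths e s|%:R)%R]).
Proof.
split; last exact: exponentially_many_paths.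
have [M [K MK]] := computes_runs (isT : all wf_loop weight_program).
(* At most 10 n^5 blocks are run, each costing at most K times the bit length (M + 6) n^3 of the
   memory bound. *)
exists (comp_loops 0 weight_program), (((10 * K * (M + 6))%:P * 'X^8)%R).
move=> n e s net.
have n3 : 3 <= n by have := network_card net; rewrite card_ord.
have n0 : 0 < n := leq_trans (isT : 0 < 3) n3.
(* From n < 2^n, n^(4n^2) <= 2^(4n^3); the summand M makes V exceed the constants of the program as
   well. *)
pose V := 2 ^ ((M + 5) * (n * n * n)).
have BV : value_bound n <= V.
  apply: (@leq_trans (2 ^ (n * (4 * (n * n))))).
    by rewrite expnM /value_bound leq_exp2r ?muln_gt0 ?n0 // ltnW // ltn_expl.
  by rewrite leq_exp2l //; nia.
have MV : M <= V.
  apply: leq_trans (ltnW (ltn_expl M (isT : 1 < 2))) _.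
  by rewrite leq_exp2l // -[leqLHS]muln1 leq_mul ?leq_addr // !muln_gt0 n0.
have V1 : 1 < V by rewrite -[1]/(2 ^ 0) ltn_exp2l // !muln_gt0 n0 addn_gt0 orbT.
have r := runs_weight_program n3 (size_adjacency e) (adjacency_le1 e) BV.
have [t cmp tT] := MK V _ _ _ V1 MV r.
exists (fractions n (adjacency e) n), t; split=> //.
  exact: fractions_represent net.
apply: leq_trans tT _.
have -> : bitlen V = ((M + 5) * (n * n * n)).+1 by rewrite /bitlen trunc_expnK.
rewrite hornerM hornerC hornerXn.
have -> : ((10 * K * (M + 6))%N * (n : nat) ^+ 8)%R = 10 * K * (M + 6) * n ^ 8.
  by [].
have T10 : run_time n <= 10 * n ^ 5.
  rewrite /run_time !expnS expn0 muln1 !mulnA.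
  have h2 : 1 <= n * n by rewrite muln_gt0 n0.
  have h3 : n * n <= n * n * n by rewrite leq_pmulr.
  have h4 : n * n * n <= n * n * n * n by rewrite leq_pmulr.
  have h5 : n * n * n * n <= n * n * n * n * n by rewrite leq_pmulr.
  have h1 : n <= n * n by rewrite leq_pmulr.
  lia.
have B : ((M + 5) * (n * n * n)).+1 <= (M + 6) * n ^ 3.
  rewrite !expnS expn0 muln1 mulnA; have m0 : 0 < n * n * n by rewrite !muln_gt0 n0.
  by move: (n * n * n) m0 => m m0; nia.
apply: leq_trans (leq_mul T10 (leq_mul (leqnn K) B)) _.
by rewrite (_ : 8 = 5 + 3) // expnD; nia.
Qed.
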